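(* Let $\rho>0$, let $L$ be a slowly varying function, and let $h:[2,\infty)\to(0,\infty)$ be non-decreasing. Suppose that $$\sum_{n\le x}\ \sum_{p^{\nu}\| n}\nu\,h(p)=\left(\frac{\zeta(\rho+1)}{\rho+1}+o(1)\right)\frac{x^{\rho+1}L(x)}{\log x}\qquad(x\to\infty).$$ Then $$h(x)\sim x^{\rho}L(x)\qquad(x\to\infty).$$
   Context: A slowly varying function $L$ is a positive, continuous function defined for $x\ge x_0$ (some $x_0>0$) satisfying $\lim_{x\to\infty}L(cx)/L(x)=1$ for every $c>0$. The letter $p$ denotes primes; $p^{\nu}\|n$ means that $p^{\nu}$ divides $n$ but $p^{\nu+1}$ does not, and the inner sum runs over all prime powers $p^\nu$ with $\nu\ge1$ and $p^\nu\|n$ (it is $0$ for $n=1$). $\zeta$ is the Riemann zeta-function. *)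

(* Defs.v *)
From HB Require Import structures.
From mathcomp Require Import all_boot all_order all_algebra.
From mathcomp Require Import all_classical all_reals all_analysis.

Set Implicit Arguments.
Unset Strict Implicit.
Unset Printing Implicit Defensive.

Import Order.TTheory GRing.Theory Num.Theory.
Import numFieldNormedType.Exports.

Local Open Scope classical_set_scope.
Local Open Scope ring_scope.

(* [L] is a total function on [R]; only its restriction to some half-line
   [x0, +oo[ is relevant. *)
Definition slowly_varying (R : realType) (L : R -> R) : Prop :=
  exists2 x0 : R, 0 < x0 &
    [/\ forall x, x0 <= x -> 0 < L x,
        {within `[x0, +oo[, continuous L} &
        forall c : R, 0 < c -> L (c * x) / L x @[x --> +oo] --> (1 : R)].

(* The Dirichlet series 1 + 2^-s + 3^-s + ...; it is the Riemann zeta-function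
   for real [s > 1] and carries no meaning for [s <= 1]. *)
Definition zeta (R : realType) (s : R) : R :=
  limn (series (fun n : nat => n.+1%:R `^ (- s))).

(* p^nu || n *)
Definition exactly_divides (p nu n : nat) : bool :=
  (p ^ nu %| n)%N && ~~ (p ^ nu.+1 %| n)%N.

(* The bounds [p <= n] and [nu <= n] lose nothing when [0 < n], since
   p^nu || n forces [nu < p ^ nu <= n]; see [prime_power_sumE]. *)
Definition prime_power_sum (R : realType) (h : R -> R) (n : nat) : R :=
  \sum_(1 <= p < n.+1 | prime p)
    \sum_(1 <= nu < n.+1 | exactly_divides p nu n) nu%:R * h p%:R.

Lemma prime_power_sumE (R : realType) (h : R -> R) (n : nat) : (0 < n)%N ->
  prime_power_sum h n = \sum_(p <- primes n) (logn p n)%:R * h p%:R.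
Proof.
move=> n0; rewrite /prime_power_sum.
have inner p : prime p ->
    \sum_(1 <= nu < n.+1 | exactly_divides p nu n) nu%:R * h p%:R
    = (logn p n)%:R * h p%:R.
  move=> pp.
  have E nu : exactly_divides p nu n = (nu == logn p n).
    rewrite /exactly_divides !pfactor_dvdn // -leqNgt.
    by rewrite eqn_leq.
  rewrite (eq_bigl _ _ E) -big_filter.
  have [/eqP l0|l0] := boolP (logn p n == 0%N).
    rewrite l0 mul0r big_filter big1 // => i /eqP ->; by rewrite mul0r.
  rewrite (perm_big [:: logn p n]) ?big_seq1 //.
  apply: uniq_perm; rewrite ?filter_uniq ?iota_uniq // => k.
  rewrite mem_filter mem_index_iota inE.
  case: eqVneq => //= ->; rewrite lt0n l0 /= ltnS.
  apply: leq_trans (dvdn_leq n0 (pfactor_dvdnn p n)).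
  by apply/ltnW/ltn_expl/prime_gt1.
rewrite (eq_bigr _ inner) (bigID (fun p => (p %| n)%N)) /=.
rewrite [X in _ + X]big1 ?addr0; last first.
  move=> p /andP[pp pn].
  by have /eqP -> : logn p n == 0%N;
    rewrite ?mul0r // -leqn0 leqNgt logn_gt0 mem_primes pp n0 (negbTE pn).
rewrite -big_filter; apply: perm_big.
apply: uniq_perm; rewrite ?primes_uniq ?filter_uniq ?iota_uniq // => p.
rewrite mem_filter mem_index_iota mem_primes n0 /=.
apply/idP/idP => [/andP[]//|/andP[pp pn]].
by rewrite pp pn prime_gt0 // ltnS dvdn_leq.
Qed.

(* Main.v *)
Require Import Defs.
From HB Require Import structures.
From mathcomp Require Import all_boot all_order all_algebra.
From mathcomp Require Import all_classical all_reals all_analysis.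
From mathcomp Require Import zify ring lra.

Set Implicit Arguments.
Unset Strict Implicit.
Unset Printing Implicit Defensive.

Import Order.TTheory GRing.Theory Num.Theory.
Import numFieldNormedType.Exports.

Local Open Scope classical_set_scope.
Local Open Scope ring_scope.

(* The left-hand side of the hypothesis is F x = \sum_(m <= x) A (x / m), where
   A x = \sum_(p ^ k <= x) h p.  Since F is monotone and F x is asymptotic to a constant
   times x ^ (rho + 1) * L x / ln x, the ratio F (c * x) / F x tends to c ^ (rho + 1), and
   F satisfies a Potter bound with an exponent larger than 1; monotonicity replaces the
   uniform convergence theorem for L here.  Mobius inversion and dominated convergence
   give A x / F x -> D for some D, and then F x = \sum_(m <= x) A (x / m) forces
   1 = D * zeta (rho + 1).  Proper prime powers are negligible, hence
   \sum_(p <= x) h p is asymptotic to x ^ (rho + 1) * L x / ((rho + 1) * ln x).  The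
   prime number theorem counts the primes of (x, (1 + d) * x], on which h is at least
   h x, and those of ((1 - d) * x, x], on which it is at most h x; letting d tend to 0
   yields h x ~ x ^ rho * L x.

   The prime number theorem is obtained from Selberg's formula, in the form
   |R x| * ln x ^ 2 <= 2 * \sum_(n <= x) ln n * |R (x / n)| + O(x * ln x) with
   R x = psi x - x.  Sums of R (x / n) over initial segments are O(x) by Mertens' estimate,
   and R decreases at most linearly, so if |R y| <= beta * y eventually, then |R (x / n)|
   is at most half of the optimal bound for a positive logarithmic proportion of the n.
   This improves beta by a fixed amount, so the infimum of the admissible beta is 0. *)

(** * Dirichlet convolution and arithmetic functions *)

Lemma truncn_divn (R : realType) (x : R) (n : nat) :
  0 <= x -> (0 < n)%N -> Num.truncn (x / n%:R) = (Num.truncn x %/ n)%N.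
Proof.
move=> x0 n0; have n0' : (0 : R) < n%:R by rewrite ltr0n.
apply: truncn_def; have /andP[h1 h2] := truncn_itv x0.
rewrite ler_pdivlMr // ltr_pdivrMr //; apply/andP; split.
  by apply: le_trans h1; rewrite -natrM ler_nat leq_divM.
by apply: lt_le_trans h2 _; rewrite -natrM ler_nat ltn_ceil.
Qed.

Lemma sum_multiples (R : nmodType) (g : nat -> R) (N d : nat) : (0 < d)%N ->
  \sum_(1 <= k < N.+1 | (d %| k)%N) g k =
  \sum_(1 <= m < (N %/ d).+1) g (d * m)%N.
Proof.
move=> d0; elim: N => [|N IH]; first by rewrite div0n !big_geq.
rewrite big_mkcond big_nat_recr //= -big_mkcond /= IH divnS //.
case: ifP => dN; last by rewrite addr0.
rewrite add1n [RHS]big_nat_recr //=; congr (_ + g _).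
have := divnS N d0; rewrite dN add1n => <-; by rewrite mulnC divnK.
Qed.

(** Both sides run over the lattice points with [n * m <= N], a condition symmetric in the two
    variables. *)
Lemma sum_hyperbola_exchange (R : nmodType) (g : nat -> nat -> R) (N : nat) :
  \sum_(1 <= n < N.+1) \sum_(1 <= m < (N %/ n).+1) g n m =
  \sum_(1 <= m < N.+1) \sum_(1 <= n < (N %/ m).+1) g n m.
Proof.
have aux (f : nat -> nat -> R) :
    \sum_(1 <= n < N.+1) \sum_(1 <= m < (N %/ n).+1) f n m =
    \sum_(1 <= n < N.+1) \sum_(1 <= m < N.+1 | (n * m <= N)%N) f n m.
  apply: eq_big_nat => n /andP[n0 nN].
  rewrite (big_nat_widen _ _ N.+1) ?ltnS ?leq_div //; apply: eq_bigl => m /=.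
  by rewrite ltnS leq_divRL // mulnC.
rewrite !aux (exchange_big_dep_nat predT) //=.
by apply: eq_bigr => m _; apply: eq_bigl => n; rewrite mulnC.
Qed.

Definition dirichlet_conv (R : nzRingType) (a b : nat -> R) (k : nat) : R :=
  \sum_(1 <= d < k.+1 | (d %| k)%N) a d * b (k %/ d)%N.

(** Group the pairs by their product [k = n * m]. Since [f] sees only the product, Moebius inversion
    and the double sums behind Selberg's formula are instances of this regrouping. *)
Lemma sum_dirichlet_conv (R : nzRingType) (a b f : nat -> R) (N : nat) :
  \sum_(1 <= n < N.+1) a n * (\sum_(1 <= m < (N %/ n).+1) b m * f (n * m)%N) =
  \sum_(1 <= k < N.+1) dirichlet_conv a b k * f k.
Proof.
transitivity (\sum_(1 <= k < N.+1) \sum_(1 <= d < N.+1 | (d %| k)%N)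
    a d * b (k %/ d)%N * f k); last first.
  apply: eq_big_nat => k /andP[k0 kN]; rewrite /dirichlet_conv big_distrl /=.
  rewrite [RHS](big_nat_widen _ _ N.+1) //; apply: eq_bigl => d /=.
  by case dk: (d %| k)%N => //=; rewrite ltnS dvdn_leq.
rewrite (exchange_big_dep_nat predT) //=; apply: eq_big_nat => n /andP[n0 nN].
rewrite sum_multiples // big_distrr /=; apply: eq_bigr => m _.
by rewrite mulKn // mulrA.
Qed.

(** The test on the exponents is squarefreeness. The value at 0 is 1, but every sum below starts at
    1. *)
Definition mobius (R : pzRingType) (n : nat) : R :=
  if all (fun p => logn p n == 1%N) (primes n) then (-1) ^+ size (primes n) else 0.

Lemma mobius1 (R : pzRingType) : mobius R 1 = 1.
Proof. by rewrite /mobius. Qed.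

Lemma ler_norm_mobius (R : numDomainType) n : `|mobius R n| <= 1.
Proof.
by rewrite /mobius; case: ifP; rewrite ?normr0 // normrX normrN1 expr1n.
Qed.

Lemma mobiusMprime (R : pzRingType) p n : prime p -> (0 < n)%N ->
  mobius R (p * n) = if (p %| n)%N then 0 else - mobius R n.
Proof.
move=> pp n0; have p0 := prime_gt0 pp; case: ifP => pn.
  rewrite /mobius ifF //; apply/negbTE/allPn; exists p.
    by rewrite mem_primes pp muln_gt0 p0 n0 dvdn_mulr.
  rewrite lognM // logn_prime // eqxx add1n eqSS -lt0n logn_gt0.
  by rewrite mem_primes pp n0.
have pm : perm_eq (primes (p * n)) (p :: primes n).
  apply: uniq_perm; rewrite ?primes_uniq //=.
    by rewrite mem_primes pn !andbF primes_uniq.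
  by move=> q; rewrite primesM // inE primes_prime // inE.
rewrite /mobius (perm_all _ pm) (perm_size pm) /= lognM // logn_prime // eqxx.
have -> : logn p n = 0%N.
  by apply/eqP; rewrite -leqn0 leqNgt logn_gt0 mem_primes pn !andbF.
rewrite /= (@eq_in_all _ _ (fun q => logn q n == 1%N)); last first.
  move=> q; rewrite mem_primes => /and3P[qp _ qn].
  rewrite lognM // logn_prime //; case: (eqVneq q p) => // qE.
  by rewrite -qE qn in pn.
by case: ifP => _; rewrite ?oppr0 // exprS mulN1r.
Qed.

(** For [n = p * m] with [p] prime, a divisor [p * i] contributes [- mobius i] if [p] does not
    divide [i], and 0 otherwise. These terms cancel the divisors of [n] that are prime to [p], which
    are those of [m]. *)
Lemma sum_mobius (R : nzRingType) n : (0 < n)%N ->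
  \sum_(1 <= d < n.+1 | (d %| n)%N) mobius R d = (n == 1%N)%:R.
Proof.
move=> n0; case: eqVneq => [->|n1].
  by rewrite big_mkcond big_nat1 /= mobius1.
have {n1} n1 : (1 < n)%N by lia.
set p := pdiv n; have pp : prime p := pdiv_prime n1.
have p0 := prime_gt0 pp.
have /dvdnP[m nE] : (p %| n)%N := pdiv_dvd n; rewrite mulnC in nE.
have m0 : (0 < m)%N by move: n0; rewrite nE muln_gt0 => /andP[].
rewrite (bigID (fun d => (p %| d)%N)) /=.
rewrite big_mkcondl /= sum_multiples // nE mulKn //.
have -> : \sum_(1 <= i < m.+1) (if (p * i %| p * m)%N then mobius R (p * i) else 0)
   = - \sum_(1 <= i < m.+1 | (i %| m)%N && ~~ (p %| i)%N) mobius R i.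
  rewrite -sumrN [RHS]big_mkcond; apply: eq_big_nat => i /andP[i0 _].
  rewrite dvdn_pmul2l //; case: ifP => //= im.
  by rewrite mobiusMprime //; case: ifP.
apply/eqP; rewrite addrC subr_eq0; apply/eqP.
rewrite [RHS](big_nat_widen _ _ (p * m).+1) ?ltnS ?leq_pmull //.
apply: eq_bigl => d /=; case pd: (p %| d)%N; rewrite ?andbF //= !andbT.
rewrite Gauss_dvdr; last by rewrite coprime_sym prime_coprime // pd.
by case dm: (d %| m)%N => //=; rewrite ltnS dvdn_leq.
Qed.

(** After regrouping, [f k] is weighted by the sum of [mobius] over the divisors of [k], which
    vanishes unless [k = 1]. The typical [f k] is [A (x / k)]. *)
Lemma mobius_inversion (R : nzRingType) (f : nat -> R) (N : nat) : (0 < N)%N ->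
  \sum_(1 <= n < N.+1) mobius R n * (\sum_(1 <= m < (N %/ n).+1) f (n * m)%N)
  = f 1%N.
Proof.
move=> N0.
have := sum_dirichlet_conv (mobius R) (fun=> 1) f N.
under eq_bigr do under eq_bigr do rewrite mul1r.
move=> ->; rewrite big_nat_recl // big_nat big1 => [|i /andP[i0 iN]].
  rewrite addr0 /dirichlet_conv (eq_bigr (mobius R)) => [|d _]; last by rewrite mulr1.
  by rewrite sum_mobius // mul1r.
rewrite /dirichlet_conv (eq_bigr (mobius R)) => [|d _]; last by rewrite mulr1.
by rewrite sum_mobius // eqSS gtn_eqF // mul0r.
Qed.

(* Uniqueness of the representation [n = p ^ k] is never needed, so the value at
   a prime power is written as a sum over all of them. *)
Definition mangoldt_of (R : nzRingType) (g : nat -> R) (n : nat) : R :=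
  \sum_(1 <= p < n.+1 | prime p) \sum_(1 <= k < n.+1) (n == p ^ k)%N%:R * g p.

(** If [n = p ^ k] with [p] prime and [k >= 1], then [p <= n] and [k <= n], so longer ranges add
    only zeros. Ranges independent of [n] make the sums exchangeable. *)
Lemma mangoldt_of_widen (R : nzRingType) (g : nat -> R) n N :
  (n <= N)%N -> (0 < n)%N -> mangoldt_of g n =
  \sum_(1 <= p < N.+1 | prime p) \sum_(1 <= k < N.+1) (n == p ^ k)%N%:R * g p.
Proof.
move=> nN n0; rewrite /mangoldt_of (big_nat_widen _ _ N.+1) //.
rewrite big_mkcond [RHS]big_mkcond; apply: eq_big_nat => p /andP[p0 pN] /=.
case: ifP => [/andP[pp pn]|]; rewrite ?pp.
  rewrite (big_nat_widen _ _ N.+1) // big_mkcond.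
  apply: eq_big_nat => k /andP[k0 kN] /=; case: ifP => // kn.
  case: eqP => [nE|]; last by rewrite mul0r.
  by move: kn; rewrite ltnS nE (ltnW (ltn_expl k (prime_gt1 pp))).
case: ifP => //= pp pn; rewrite big1_seq // => k /andP[_].
rewrite mem_index_iota => /andP[k0 _]; case: eqP => [nE|]; last by rewrite mul0r.
by move: pn; rewrite ltnS nE -{1}(expn1 p) leq_exp2l ?prime_gt1 // k0.
Qed.

Lemma mangoldt_of_ge0 (R : numDomainType) (g : nat -> R) n :
  (forall p, prime p -> 0 <= g p) -> 0 <= mangoldt_of g n.
Proof.
move=> g0; apply: sumr_ge0 => p pp; apply: sumr_ge0 => k _.
by rewrite mulr_ge0 ?ler0n ?g0.
Qed.

(** A prime [p] is met once for each [k >= 1] with [p ^ k] dividing [n], hence [logn p n] times. *)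
Lemma sum_mangoldt_of_dvd (R : nzRingType) (g : nat -> R) n : (0 < n)%N ->
  \sum_(1 <= d < n.+1 | (d %| n)%N) mangoldt_of g d =
  \sum_(p <- primes n) (logn p n)%:R * g p.
Proof.
move=> n0.
have -> : \sum_(1 <= d < n.+1 | (d %| n)%N) mangoldt_of g d =
    \sum_(1 <= d < n.+1) \sum_(1 <= p < n.+1 | prime p)
      \sum_(1 <= k < n.+1) (d %| n)%N%:R * ((d == p ^ k)%N%:R * g p).
  rewrite big_mkcond; apply: eq_big_nat => d /andP[d0 dn].
  rewrite (@mangoldt_of_widen _ _ d n) //; case: (d %| n)%N.
    by do 2![apply: eq_bigr => ? _]; rewrite mul1r.
  by rewrite big1 // => p _; rewrite big1 // => k _; rewrite mul0r.
rewrite (exchange_big_dep_nat prime) //=.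
rewrite (eq_bigr (fun p => (logn p n)%:R * g p)); last first.
  move=> p pp; rewrite (exchange_big_dep_nat predT) //=.
  rewrite (eq_big_nat _ _ (F2 := fun k => (p ^ k %| n)%N%:R * g p)); last first.
    move=> k /andP[k0 kn].
    case: (boolP (p ^ k %| n)%N) => pk; last first.
      rewrite big1 ?mul0r // => d _; case: eqP => [->|]; rewrite ?mul0r ?mulr0 //.
      by rewrite (negbTE pk) mul0r.
    have pk0 : (0 < p ^ k)%N by rewrite expn_gt0 prime_gt0.
    have kin : (p ^ k)%N \in index_iota 1 n.+1.
      by rewrite mem_index_iota pk0 ltnS dvdn_leq.
    rewrite pp (bigD1_seq _ kin (iota_uniq _ _)) /= eqxx pk !mul1r.
    by rewrite big1 ?addr0 // => d /negbTE ->; rewrite mul0r mulr0.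
  rewrite -big_distrl /=; congr (_ * _).
  (* [logn_count_dvd] counts exponents below [n] only; the extra term [k = n] is zero because
     [p ^ n > n]. *)
  rewrite (logn_count_dvd n pp) natr_sum big_nat_recr //=.
  suff -> : (p ^ n %| n)%N = false by rewrite addr0.
  by apply/negP => /dvdn_leq; rewrite n0 leqNgt ltn_expl ?prime_gt1 // => /(_ isT).
rewrite (bigID (fun p => (p %| n)%N)) /= [X in _ + X]big1 ?addr0; last first.
  move=> p /andP[pp pn]; suff -> : logn p n = 0%N by rewrite mul0r.
  by apply/eqP; rewrite -leqn0 leqNgt logn_gt0 mem_primes pp n0 (negbTE pn).
rewrite -big_filter; apply: perm_big.
apply: uniq_perm; rewrite ?primes_uniq ?filter_uniq ?iota_uniq // => p.
rewrite mem_filter mem_index_iota mem_primes n0 /=.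
apply/idP/idP => [/andP[]//|/andP[pp pn]].
by rewrite pp pn prime_gt0 // ltnS dvdn_leq.
Qed.

Lemma sum_logn_ln (R : realType) n : (0 < n)%N ->
  \sum_(p <- primes n) (logn p n)%:R * ln (p%:R : R) = ln (n%:R : R).
Proof.
move=> n0; rewrite {3}(prod_prime_decomp n0) prime_decompE big_map /=.
have: all (fun p => 0 < p)%N (primes n).
  by apply/allP => p; rewrite mem_primes => /andP[/prime_gt0].
elim: (primes n) => [|p s IH] /=; first by rewrite !big_nil ln1.
case/andP=> p0 s0; rewrite !big_cons IH // natrM lnM ?posrE.
- by rewrite natrX lnXn ?ltr0n // mulr_natl.
- by rewrite ltr0n expn_gt0 p0.
rewrite ltr0n; elim: (s) s0 => [|q t IHt] /=; rewrite ?big_nil //.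
by case/andP=> q0 /IHt t0; rewrite big_cons muln_gt0 t0 expn_gt0 q0.
Qed.

(** The von Mangoldt function. The main theorem uses [mangoldt_of] with the values of [h] instead of
    logarithms, hence the parameter [g]. *)
Definition mangoldt (R : realType) : nat -> R := mangoldt_of (fun p => ln p%:R).

Lemma mangoldt_ge0 (R : realType) n : 0 <= mangoldt R n.
Proof. by apply: mangoldt_of_ge0 => p pp; rewrite ln_ge0 // ler1n prime_gt0. Qed.

Lemma sum_mangoldt_dvd (R : realType) n : (0 < n)%N ->
  \sum_(1 <= d < n.+1 | (d %| n)%N) mangoldt R d = ln n%:R.
Proof. by move=> n0; rewrite sum_mangoldt_of_dvd // sum_logn_ln. Qed.

(** * Estimates of Chebyshev and Mertens *)

Definition summatory (R : realType) (f : nat -> R) (x : R) : R :=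
  \sum_(1 <= n < (Num.truncn x).+1) f n.

Lemma summatory_div (R : realType) (f : nat -> R) (x : R) n : 0 <= x -> (0 < n)%N ->
  summatory f (x / n%:R) = \sum_(1 <= m < (Num.truncn x %/ n).+1) f m.
Proof. by move=> x0 n0; rewrite /summatory truncn_divn. Qed.

Lemma summatory_nat (R : realType) (f : nat -> R) N :
  summatory f N%:R = \sum_(1 <= m < N.+1) f m.
Proof. by rewrite /summatory natrK. Qed.

Lemma lnB_le (R : realType) (a b : R) : 0 < a -> 0 < b -> ln b - ln a <= (b - a) / a.
Proof.
move=> a0 b0; rewrite -ln_div ?posrE //.
have -> : b / a = 1 + (b - a) / a by field; rewrite gt_eqF.
apply: le_ln1Dx; rewrite mulrBl divff ?gt_eqF //.
by rewrite ltrBrDr addrC subrr divr_gt0.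
Qed.

Lemma lnB_ge (R : realType) (a b : R) : 0 < a -> 0 < b -> (b - a) / b <= ln b - ln a.
Proof.
move=> a0 b0; rewrite -[leLHS]opprK -[leRHS]opprK lerN2 opprB -mulNr opprB.
exact: lnB_le.
Qed.

Lemma ln_leB1 (R : realType) (x : R) : 0 < x -> ln x <= x - 1.
Proof. by move=> x0; have := @lnB_le R 1 x ltr01 x0; rewrite ln1 subr0 divr1. Qed.

Lemma truncn_bounds (R : realType) (x : R) : 1 <= x ->
  [/\ 1 <= (Num.truncn x)%:R :> R, (Num.truncn x)%:R <= x & x < (Num.truncn x)%:R + 1].
Proof.
move=> x1; have /andP[h1 h2] := truncn_itv (le_trans ler01 x1).
by rewrite ler1n truncn_gt0 x1 h1 natr1 h2.
Qed.

Definition harmonic_sum (R : realType) (N : nat) : R :=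
  \sum_(1 <= n < N.+1) n%:R^-1.

(** [harmonic_sum N - ln N] decreases, and it increases once [1 / N] is subtracted; [g] is the
    supremum of the second sequence and lies between the two. *)
Lemma euler_mascheroni (R : realType) : exists g : R, forall N, (0 < N)%N ->
  0 <= harmonic_sum R N - ln N%:R - g <= N%:R^-1.
Proof.
pose u N : R := harmonic_sum R N.+1 - ln N.+1%:R.
pose v N : R := u N - N.+1%:R^-1.
have p (n : nat) : (0 : R) < n.+1%:R by rewrite ltr0n.
have step N : u N.+1 = u N + N.+2%:R^-1 - (ln N.+2%:R - ln N.+1%:R).
  by rewrite /u /harmonic_sum [in LHS]big_nat_recr //=; ring.
have e N : N.+2%:R - N.+1%:R = 1 :> R by rewrite -[N.+2%:R]natr1; ring.
have ud N : u N.+1 <= u N.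
  by have := lnB_ge (p N) (p N.+1); rewrite step e div1r; move: (N.+2%:R^-1) => i; lra.
have vi N : v N <= v N.+1.
  have := lnB_le (p N) (p N.+1); rewrite /v step e div1r.
  by move: (N.+1%:R^-1) (N.+2%:R^-1) => i j; lra.
have uD m n : u (n + m)%N <= u n.
  by elim: m => [|m IH]; rewrite ?addn0 // addnS (le_trans (ud _)).
have vD m n : v n <= v (n + m)%N.
  by elim: m => [|m IH]; rewrite ?addn0 // addnS (le_trans IH).
have vu m n : v m <= u n.
  apply: (le_trans (vD n m)); apply: (le_trans _ (uD m n)).
  by rewrite addnC /v gerBl invr_ge0 ltW.
have hs : has_sup (range v).
  by split; [exists (v 0%N); exists 0%N | exists (u 0%N) => _ [n _ <-]].
exists (sup (range v)) => [[//|N]] _; rewrite -/(u N).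
have h1 : v N <= sup (range v) by apply: ub_le_sup; [case: hs | exists N].
have h2 : sup (range v) <= u N by apply: ge_sup; [case: hs | move=> _ [n _ <-]].
by move: h1; rewrite /v; move: (N.+1%:R^-1) => i h1; apply/andP; split; lra.
Qed.

Lemma harmonic_sum_real (R : realType) : exists g : R, forall x, 1 <= x ->
  `|harmonic_sum R (Num.truncn x) - ln x - g| <= 2 / x.
Proof.
have [g hg] := euler_mascheroni R; exists g => x x1.
have [N1 Nx xN] := truncn_bounds x1; set N := Num.truncn x in N1 Nx xN *.
have N0 : 0 < N%:R :> R by lra.
have x0 : 0 < x by lra.
have /hg/andP[h1 h2] : (0 < N)%N by rewrite truncn_gt0.
have i2 : N%:R^-1 <= 2 / x.
  by rewrite -div1r ler_pdivrMr // mulrAC ler_pdivlMr //; lra.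
have k1 : ln x - ln N%:R <= N%:R^-1.
  by apply: (le_trans (lnB_le N0 x0)); rewrite ler_pdivrMr // mulVf ?gt_eqF //; lra.
have k2 : 0 <= ln x - ln N%:R by rewrite subr_ge0 ler_ln ?posrE.
by rewrite ler_norml; apply/andP; split; lra.
Qed.

Lemma sum_ln (R : realType) N : \sum_(1 <= n < N.+1) ln (n%:R : R) = ln (N`!)%:R.
Proof.
elim: N => [|N IH]; first by rewrite big_geq // ln1.
by rewrite big_nat_recr //= IH factS natrM mulrC lnM ?posrE ?ltr0n ?fact_gt0.
Qed.

Lemma harmonic_sum_le (R : realType) N : (0 < N)%N -> harmonic_sum R N <= 1 + ln N%:R.
Proof.
case: N => // N _; elim: N => [|N IH].
  by rewrite /harmonic_sum big_nat1 ln1 invr1 addr0.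
rewrite /harmonic_sum big_nat_recr //= -/(harmonic_sum _ _).
have := @lnB_ge R N.+1%:R N.+2%:R (ltr0Sn _ _) (ltr0Sn _ _).
rewrite -[X in (X - _) / _]natr1 addrAC subrr add0r div1r.
by move: (N.+2%:R^-1) => i; lra.
Qed.

Lemma harmonic_sum_ge (R : realType) N : ln N.+1%:R <= harmonic_sum R N.
Proof.
elim: N => [|N IH]; first by rewrite /harmonic_sum big_geq // ln1.
rewrite /harmonic_sum big_nat_recr //= -/(harmonic_sum _ _).
have := @lnB_le R N.+1%:R N.+2%:R (ltr0Sn _ _) (ltr0Sn _ _).
rewrite -[X in (X - _) / _]natr1 addrAC subrr add0r div1r.
by move: (N.+1%:R^-1) => i; lra.
Qed.

(** From [a] to [a + 1] the error grows by [1 - a * (ln (a + 1) - ln a)], which lies between 0 and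
    [1 / (a + 1)]. It is therefore nonnegative and at most the harmonic sum. *)
Lemma stirling (R : realType) N : (0 < N)%N ->
  `|ln (N`!)%:R - (N%:R * ln N%:R - N%:R)| <= 1 + ln (N%:R : R).
Proof.
move=> N0; suff : (0 : R) <= ln (N`!)%:R - (N%:R * ln N%:R - N%:R) <= harmonic_sum R N.
  by case/andP=> h1 h2; rewrite ger0_norm // (le_trans h2) // harmonic_sum_le.
case: N N0 => // N _; elim: N => [|N /andP[IH1 IH2]].
  by rewrite factS fact0 mul1n /harmonic_sum big_nat1 ln1 invr1; lra.
rewrite /harmonic_sum big_nat_recr //= -/(harmonic_sum _ _).
rewrite factS natrM lnM ?posrE ?ltr0n ?fact_gt0 //.
set a : R := N.+1%:R in IH1 IH2 *; have -> : N.+2%:R = a + 1 :> R by rewrite natr1.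
have a0 : 0 < a by rewrite ltr0n.
have a1 : 0 < a + 1 by lra.
have := lnB_le a0 a1; have := lnB_ge a0 a1.
rewrite addrAC subrr add0r !div1r => h1 h2.
have k2 : a * (ln (a + 1) - ln a) <= 1.
  by rewrite -ler_pdivlMl // mulr1.
have k1 : a * (a + 1)^-1 <= a * (ln (a + 1) - ln a) by rewrite ler_pM2l.
have k3 : a * (a + 1)^-1 = 1 - (a + 1)^-1 by field; rewrite gt_eqF.
by apply/andP; split; lra.
Qed.

Lemma stirling_real (R : realType) (x : R) : 1 <= x ->
  `|ln ((Num.truncn x)`!)%:R - (x * ln x - x)| <= 3 + 2 * ln x.
Proof.
move=> x1; have [N1 Nx xN] := truncn_bounds x1.
have := @stirling R (Num.truncn x); rewrite truncn_gt0 => /(_ x1).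
set N := (Num.truncn x)%:R : R in N1 Nx xN *; set T := ln _.
have N0 : 0 < N by lra.
have x0 : 0 < x by lra.
have l0 : 0 <= ln x by rewrite ln_ge0.
have lN : ln N <= ln x by rewrite ler_ln ?posrE.
rewrite !ler_norml => /andP[h1 h2].
have k1 := lnB_le N0 x0; rewrite ler_pdivlMr // in k1.
have k2 : 0 <= N * (ln x - ln N) by rewrite mulr_ge0 ?subr_ge0 ?(ltW N0).
have k3 : 0 <= (x - N) * ln x by rewrite mulr_ge0 // subr_ge0.
have k4 : (x - N) * ln x <= ln x by rewrite ler_piMl //; lra.
by apply/andP; split; lra.
Qed.

Lemma sum_divisor_sum (R : realType) (a : nat -> R) N :
  \sum_(1 <= k < N.+1) \sum_(1 <= d < k.+1 | (d %| k)%N) a d =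
  \sum_(1 <= m < N.+1) \sum_(1 <= d < (N %/ m).+1) a d.
Proof.
rewrite sum_hyperbola_exchange.
transitivity (\sum_(1 <= k < N.+1) dirichlet_conv a (fun=> 1) k * 1).
  by do 2![apply: eq_bigr => ? _; rewrite ?mulr1].
rewrite -(sum_dirichlet_conv a (fun=> 1) (fun=> 1)).
apply: eq_bigr => d _; rewrite mulr_sumr.
by apply: eq_bigr => m _; rewrite !mulr1.
Qed.

Lemma sum_divisor_sum_floor (R : realType) (a : nat -> R) N :
  \sum_(1 <= k < N.+1) \sum_(1 <= d < k.+1 | (d %| k)%N) a d =
  \sum_(1 <= d < N.+1) a d * (N %/ d)%:R.
Proof.
rewrite sum_divisor_sum sum_hyperbola_exchange; apply: eq_bigr => d _.
by rewrite sumr_const_nat subn1 /= mulr_natr.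
Qed.

Lemma ln_fact_floor (R : realType) N :
  ln (N`!)%:R = \sum_(1 <= d < N.+1) mangoldt R d * (N %/ d)%:R.
Proof.
rewrite -sum_divisor_sum_floor -sum_ln; apply: eq_big_nat => n /andP[n0 _].
by rewrite sum_mangoldt_dvd.
Qed.

Definition psi (R : realType) (x : R) : R := summatory (mangoldt R) x.

Lemma ln_fact_psi (R : realType) (x : R) : 0 <= x ->
  ln ((Num.truncn x)`!)%:R = summatory (fun n => psi (x / n%:R)) x.
Proof.
move=> x0; rewrite -sum_ln.
transitivity (\sum_(1 <= k < (Num.truncn x).+1)
    \sum_(1 <= d < k.+1 | (d %| k)%N) mangoldt R d).
  by apply: eq_big_nat => n /andP[n0 _]; rewrite sum_mangoldt_dvd.
rewrite sum_divisor_sum; apply: eq_big_nat => n /andP[n0 _].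
by rewrite /psi summatory_div.
Qed.

Lemma psi_truncn (R : realType) (x : R) : psi x = psi (Num.truncn x)%:R.
Proof. by rewrite /psi summatory_nat. Qed.

Lemma ler_psi (R : realType) (x y : R) : x <= y -> psi x <= psi y.
Proof.
move=> xy; rewrite /psi /summatory [leRHS](big_cat_nat _ (n := (Num.truncn x).+1)) //=.
  by rewrite lerDl sumr_ge0 // => i _; rewrite mangoldt_ge0.
by rewrite ltnS le_truncn.
Qed.

Lemma psi_ge0 (R : realType) (x : R) : 0 <= psi x.
Proof. by apply: sumr_ge0 => i _; exact: mangoldt_ge0. Qed.

Lemma leq_bin_expn n m : ('C(n, m) <= 2 ^ n)%N.
Proof.
elim: n m => [|n IH] [|m]; rewrite ?bin0 ?expn_gt0 //.
by rewrite binS expnS mul2n -addnn leq_add.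
Qed.

(** With [M = N %/ 2], the binomial coefficient ['C(N, M)] costs a factor [2 ^ N]. A second one
    absorbs the factor [M.+1] that appears when [N] is odd and [N - M = M.+1]. *)
Lemma fact_half_bound N : (N`! <= 4 ^ N * (N %/ 2)`! ^ 2)%N.
Proof.
set M := (N %/ 2)%N; have MN : (M <= N)%N by rewrite leq_div.
rewrite -(bin_fact MN) (_ : 4 = 2 * 2)%N // expnMn -mulnA leq_mul ?leq_bin_expn //.
rewrite expnS expn1 mulnCA leq_mul //.
have : (N - M = M \/ N - M = M.+1)%N by rewrite /M; lia.
case=> E; rewrite E; first by rewrite leq_pmull ?expn_gt0.
rewrite factS leq_mul //; apply: (@leq_trans (2 ^ M.+1)).
  exact: ltnW (ltn_expl _ _).
by rewrite leq_exp2l //; lia.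
Qed.

Lemma ln_fact_half (R : realType) N :
  ln (N`!)%:R - 2 * ln ((N %/ 2)`!)%:R <= 3 * N%:R :> R.
Proof.
rewrite lerBlDr; have h : (N`!)%:R <= (4 ^ N * (N %/ 2)`! ^ 2)%:R :> R.
  by rewrite ler_nat fact_half_bound.
have := h; rewrite -ler_ln ?posrE ?ltr0n ?muln_gt0 ?expn_gt0 ?fact_gt0 //.
move/le_trans; apply; rewrite natrM !natrX lnM ?posrE ?exprn_gt0 ?ltr0n ?fact_gt0 //.
rewrite !lnXn ?ltr0n ?fact_gt0 // [2 * _]mulr_natl lerD2r -[leLHS]mulr_natr ler_wpM2r //.
by have := @ln_leB1 R 4 (ltr0n _ _); lra.
Qed.

(** By [ln_fact_floor], the right side weights [mangoldt d] by [N %/ d - 2 * (M %/ d)], which is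
    never negative and is at least 1 for [M < d <= N]. *)
Lemma psi_half (R : realType) N :
  psi (N%:R : R) - psi (N %/ 2)%:R <= ln (N`!)%:R - 2 * ln ((N %/ 2)`!)%:R.
Proof.
set M := (N %/ 2)%N; have MN : (M <= N)%N by rewrite leq_div.
rewrite /psi !summatory_nat !ln_fact_floor.
rewrite !(big_cat_nat _ (m := 1%N) (n := M.+1) (p := N.+1)) //=.
set A := \sum_(1 <= i < M.+1) _; set B := \sum_(M.+1 <= i < N.+1) _.
set A' := \sum_(1 <= i < M.+1) _; set B' := \sum_(M.+1 <= i < N.+1) _.
set A'' := \sum_(1 <= i < M.+1) _.
have h1 : B <= B'.
  apply: ler_sum_nat => d /andP[d1 d2]; rewrite ler_peMr ?mangoldt_ge0 // ler1n.
  by rewrite divn_gt0 // (leq_trans _ d1).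
have h2 : 2 * A'' <= A'.
  rewrite mulr_sumr; apply: ler_sum_nat => d /andP[d1 d2].
  rewrite mulrCA ler_wpM2l ?mangoldt_ge0 // -natrM ler_nat leq_divRL //.
  by rewrite -mulnA mulnC -leq_divRL // leq_divM.
by lra.
Qed.

Lemma psi_nat_le (R : realType) N : psi (N%:R : R) <= 6 * N%:R.
Proof.
elim/ltn_ind: N => [[|N]] IH; first by rewrite /psi summatory_nat big_geq // mulr0.
have lt : (N.+1 %/ 2 < N.+1)%N by rewrite ltn_Pdiv.
have := IH _ lt; have := psi_half R N.+1; have := ln_fact_half R N.+1.
have : 2 * (N.+1 %/ 2)%:R <= N.+1%:R :> R by rewrite -natrM ler_nat mulnC leq_divM.
by lra.
Qed.

Lemma psi_le (R : realType) (x : R) : 0 <= x -> psi x <= 6 * x.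
Proof.
move=> x0; rewrite psi_truncn (le_trans (psi_nat_le _ _)) //.
by rewrite ler_pM2l // truncn_le.
Qed.

(** Replacing [N %/ d] by [N / d] in [ln_fact_floor] costs at most [psi N <= 6 * N]. Stirling's
    estimate and a division by [N] finish. *)
Lemma mertens (R : realType) (x : R) : 1 <= x ->
  `|summatory (fun n => mangoldt R n / n%:R) x - ln x| <= 10.
Proof.
move=> x1; have [N1 Nx xN] := truncn_bounds x1.
have := @stirling R (Num.truncn x); rewrite truncn_gt0 => /(_ x1).
rewrite ln_fact_floor /summatory; set N := Num.truncn x in N1 Nx xN *.
set S := \sum_(1 <= n < N.+1) _ / _; set T := \sum_(1 <= d < N.+1) _ * _.
have N0 : 0 < N%:R :> R by lra.
have x0 : 0 < x by lra.
have h1 : T <= N%:R * S.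
  rewrite mulr_sumr; apply: ler_sum_nat => d /andP[d0 _].
  rewrite mulrCA ler_wpM2l ?mangoldt_ge0 // ler_pdivlMr ?ltr0n // -natrM ler_nat.
  exact: leq_divM.
have h2 : N%:R * S - psi N%:R <= T.
  rewrite mulr_sumr /psi summatory_nat -sumrB; apply: ler_sum_nat => d /andP[d0 _].
  rewrite mulrCA -{2}[mangoldt R d]mulr1 -mulrBr ler_wpM2l ?mangoldt_ge0 //.
  rewrite lerBlDr natr1 ler_pdivrMr ?ltr0n // -natrM ler_nat ltnW // ltn_ceil //.
have h3 := psi_nat_le R N; rewrite !ler_norml => /andP[k1 k2].
have k3 := ln_leB1 N0.
have l1 : N%:R * (S - ln N%:R) <= N%:R * 8 by rewrite mulrBr; lra.
have l2 : N%:R * (- 8) <= N%:R * (S - ln N%:R) by rewrite mulrBr; lra.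
rewrite !ler_pM2l // in l1 l2.
have j1 : ln x - ln N%:R <= 1.
  by apply: (le_trans (lnB_le N0 x0)); rewrite ler_pdivrMr //; lra.
have j2 : 0 <= ln x - ln N%:R by rewrite subr_ge0 ler_ln ?posrE.
by apply/andP; split; lra.
Qed.

(** * Selberg's formula *)

Lemma sum_invsqrt (R : realType) N :
  \sum_(1 <= n < N.+1) (Num.sqrt (n%:R : R))^-1 <= 2 * Num.sqrt N%:R.
Proof.
elim: N => [|N IH]; first by rewrite big_geq // mulr_ge0 ?sqrtr_ge0.
rewrite big_nat_recr //=.
set a := Num.sqrt (N%:R : R) in IH *; set b := Num.sqrt (N.+1%:R : R).
have a0 : 0 <= a := sqrtr_ge0 _.
have b0 : 0 < b by rewrite sqrtr_gt0 ltr0n.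
have ab : a ^+ 2 + 1 = b ^+ 2 by rewrite !sqr_sqrtr ?ler0n // natr1.
have le_ab : a <= b by rewrite ler_wsqrtr // ler_nat.
apply: (le_trans (lerD IH (lexx _))).
rewrite -lerBrDl -div1r ler_pdivrMr //; nra.
Qed.

(** With [y = t ^ 4], [ln y = 4 * ln t <= 4 * (t - 1)]. *)
Lemma sqr_ln_le_sqrt (R : realType) (y : R) : 1 <= y ->
  (1 + ln y) ^+ 2 <= 16 * Num.sqrt y.
Proof.
move=> y1; have y0 : 0 <= y by lra.
set s := Num.sqrt y; set t := Num.sqrt s.
have sE : t ^+ 2 = s by rewrite sqr_sqrtr ?sqrtr_ge0.
have yE : t ^+ 4 = y by rewrite (exprM t 2 2) sE sqr_sqrtr.
have t0 : 0 < t by rewrite !sqrtr_gt0; lra.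
have h : ln y <= 4 * (t - 1).
  by rewrite -yE lnXn // -[leLHS]mulr_natl ler_wpM2l // ln_leB1.
have l0 : 0 <= ln y by rewrite ln_ge0.
rewrite -sE (_ : 16 * t ^+ 2 = (4 * t) ^+ 2); last by ring.
by rewrite ler_pXn2r ?nnegrE //; lra.
Qed.

(** Adding the same sum with [ln m] in place of [ln n] produces [ln (n * m)], and Moebius inversion
    for [ln k * f k] gives [ln 1 * f 1 = 0]. The added sum is evaluated by writing [ln m] as the sum
    of [mangoldt] over the divisors of [m]. *)
Lemma mobius_ln_sum (R : realType) (f : nat -> R) N : (0 < N)%N ->
  \sum_(1 <= n < N.+1) mobius R n * ln n%:R * (\sum_(1 <= m < (N %/ n).+1) f (n * m)%N)
  = - \sum_(1 <= n < N.+1) mangoldt R n * f n.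
Proof.
move=> N0.
have E1 := mobius_inversion (fun k => ln k%:R * f k) N0.
rewrite ln1 mul0r in E1.
have E2 : \sum_(1 <= n < N.+1) mobius R n *
    (\sum_(1 <= m < (N %/ n).+1) ln m%:R * f (n * m)%N) =
    \sum_(1 <= n < N.+1) mangoldt R n * f n.
  transitivity (\sum_(1 <= n < N.+1) \sum_(1 <= d < (N %/ n).+1)
     mobius R n * (mangoldt R d * \sum_(1 <= l < (N %/ n %/ d).+1) f (n * (d * l))%N)).
    apply: eq_big_nat => n /andP[n0 _]; rewrite -mulr_sumr; congr (_ * _).
    have := sum_dirichlet_conv (mangoldt R) (fun=> 1) (fun k => f (n * k)%N) (N %/ n).
    under eq_bigr do under eq_bigr do rewrite mul1r.
    move=> ->; apply: eq_big_nat => m /andP[m0 _]; rewrite /dirichlet_conv.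
    by rewrite -(sum_mangoldt_dvd R m0); congr (_ * _); apply: eq_bigr => d _; rewrite mulr1.
  rewrite sum_hyperbola_exchange; apply: eq_big_nat => d /andP[d0 dN].
  have Nd : (0 < N %/ d)%N by rewrite divn_gt0.
  rewrite -(muln1 d) -(mobius_inversion (fun k => f (d * k)%N) Nd) muln1 mulr_sumr.
  apply: eq_bigr => n _; rewrite mulrCA divnAC; congr (_ * (_ * _)).
  by apply: eq_bigr => l _; rewrite mulnCA.
apply/eqP; rewrite -addr_eq0 -E2 -[X in _ == X]E1 -big_split /=; apply/eqP.
apply: eq_big_nat => n /andP[n0 _]; rewrite -mulrA -mulrDr; congr (_ * _).
rewrite mulr_sumr -big_split /=; apply: eq_big_nat => m /andP[m0 _].
by rewrite natrM lnM ?posrE ?ltr0n // mulrDl.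
Qed.

(** Expand [ln (x / n) = ln x - ln n]: Moebius inversion handles the first part and [mobius_ln_sum]
    the second. The identity turns a good bound for the averages [H] into information on
    [F x * ln x]. *)
Lemma tatuzawa_iseki (R : realType) (F : R -> R) (x : R) : 1 <= x ->
  let H y := summatory (fun m => F (y / m%:R)) y in
  summatory (fun n => mobius R n * (ln (x / n%:R) * H (x / n%:R))) x =
  F x * ln x + summatory (fun n => mangoldt R n * F (x / n%:R)) x.
Proof.
move=> x1 H; have x0 : 0 < x by lra.
rewrite /summatory; set N := Num.truncn x.
have N0 : (0 < N)%N by rewrite truncn_gt0.
pose f k := F (x / k%:R).
have HE n : (0 < n)%N -> H (x / n%:R) = \sum_(1 <= m < (N %/ n).+1) f (n * m)%N.
  move=> n0; rewrite /H summatory_div ?ltW //.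
  by apply: eq_bigr => m _; rewrite /f natrM invfM mulrA.
transitivity (ln x * (\sum_(1 <= n < N.+1) mobius R n *
    (\sum_(1 <= m < (N %/ n).+1) f (n * m)%N)) -
  \sum_(1 <= n < N.+1) mobius R n * ln n%:R * (\sum_(1 <= m < (N %/ n).+1) f (n * m)%N)).
  rewrite mulr_sumr -sumrB; apply: eq_big_nat => n /andP[n0 _].
  by rewrite HE // ln_div ?posrE ?ltr0n //; ring.
by rewrite mobius_inversion // mobius_ln_sum // opprK /f divr1 mulrC.
Qed.

Definition psi_err (R : realType) (x : R) : R := psi x - x.

Lemma psi_err_le (R : realType) (x : R) : 0 <= x -> `|psi_err x| <= 7 * x.
Proof.
move=> x0; have := psi_le x0; have := psi_ge0 x.
by rewrite /psi_err ler_norml => *; apply/andP; split; lra.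
Qed.

(** The terms [y * ln y] of [ln_fact_psi] and of [y] times the harmonic sum cancel, leaving
    [- (g + 1) * y] with [g] Euler's constant. The shift by [g + 1] removes it up to the fractional
    part of [y], so only a logarithm remains. *)
Lemma psi_err_divisor_bound (R : realType) : exists g K : R, 0 <= K /\
  forall y, 1 <= y ->
  `|summatory (fun m => psi_err (y / m%:R) + (g + 1)) y| <= K * (1 + ln y).
Proof.
have [g hg] := harmonic_sum_real R.
exists g, (5 + `|g + 1|); split; first by have := normr_ge0 (g + 1); lra.
move=> y y1; have y0 : 0 < y by lra.
have -> : summatory (fun m => psi_err (y / m%:R) + (g + 1)) y =
   (ln ((Num.truncn y)`!)%:R - (y * ln y - y)) -
   y * (harmonic_sum R (Num.truncn y) - ln y - g) -
   (g + 1) * (y - (Num.truncn y)%:R).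
  rewrite ln_fact_psi ?ltW // /summatory big_split /= /psi_err sumrB.
  by rewrite sumr_const_nat subn1 /= -mulr_sumr -/(harmonic_sum _ _) -mulr_natr; ring.
have h1 := stirling_real y1; have h2 := hg _ y1.
have [_ N1 N2] := truncn_bounds y1.
have h3 : `|y * (harmonic_sum R (Num.truncn y) - ln y - g)| <= 2.
  rewrite normrM gtr0_norm // -ler_pdivlMl // mulrC; exact: h2.
have h4 : `|(g + 1) * (y - (Num.truncn y)%:R)| <= `|g + 1|.
  rewrite normrM ler_piMr // ger0_norm; lra.
have l0 : 0 <= ln y by rewrite ln_ge0.
have := mulr_ge0 (normr_ge0 (g + 1)) l0.
set A := ln _ - _ in h1 *; set B := y * _ in h3 *; set D := _ * (y - _) in h4 *.
have := ler_normB (A - B) D; have := ler_normB A B; nra.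
Qed.

(** Apply [tatuzawa_iseki] to [psi_err + (g + 1)]. The Moebius side is bounded termwise by
    [16 * K * sqrt (x / n)], which sums to [O(x)]; the constant contributes
    [(g + 1) * (ln x + psi x)], also [O(x)]. *)
Lemma selberg_linear (R : realType) : exists2 C : R, 0 <= C & forall x, 1 <= x ->
  `|psi_err x * ln x + summatory (fun n => mangoldt R n * psi_err (x / n%:R)) x| <= C * x.
Proof.
have [g [K [K0 hK]]] := psi_err_divisor_bound R.
exists (32 * K + `|g + 1| * 7) => [|x x1].
  by rewrite addr_ge0 ?mulr_ge0.
have x0 : 0 < x by lra.
pose S := summatory (fun n => mobius R n * (ln (x / n%:R) *
  summatory (fun m => psi_err (x / n%:R / m%:R) + (g + 1)) (x / n%:R))) x.
have SE : S = _ := tatuzawa_iseki (fun y => psi_err y + (g + 1)) x1.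
have hS : `|S| <= 32 * K * x.
  rewrite /S /summatory; apply: (le_trans (ler_norm_sum _ _ _)).
  apply: (@le_trans _ _ (\sum_(1 <= n < (Num.truncn x).+1)
    16 * K * Num.sqrt x * (Num.sqrt (n%:R))^-1)).
    apply: ler_sum_nat => n /andP[n1]; rewrite ltnS => nN.
    have n0 : 0 < n%:R :> R by rewrite ltr0n.
    have xn : 1 <= x / n%:R.
      by rewrite ler_pdivlMr // mul1r -truncn_ge_nat ?ltW.
    have l0 : 0 <= ln (x / n%:R) by rewrite ln_ge0.
    rewrite !normrM.
    have e1 := ler_norm_mobius R n; have e2 := hK _ xn.
    have e3 := sqr_ln_le_sqrt xn; rewrite (sqrtrM _ (ltW x0)) (sqrtrV (ltW n0)) in e3.
    apply: (@le_trans _ _ (1 * ((1 + ln (x / n%:R)) * (K * (1 + ln (x / n%:R)))))).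
      rewrite ler_pM ?mulr_ge0 // ler_pM //.
      by rewrite ger0_norm // lerDr.
    rewrite mul1r mulrCA -expr2.
    by rewrite (le_trans (ler_wpM2l K0 e3)) // le_eqVlt; apply/orP; left; apply/eqP; ring.
  rewrite -mulr_sumr; have := sum_invsqrt R (Num.truncn x).
  have : Num.sqrt (Num.truncn x)%:R <= Num.sqrt x.
    by rewrite ler_wsqrtr // truncn_le ltW.
  move=> s1 s2; have s3 := le_trans s2 (ler_wpM2l (ler0n _ 2) s1).
  have s0 := sqrtr_ge0 x.
  have k0 : 0 <= 16 * K * Num.sqrt x by rewrite !mulr_ge0.
  rewrite (le_trans (ler_wpM2l k0 s3)) // -{3}(sqr_sqrtr (ltW x0)) le_eqVlt.
  by apply/orP; left; apply/eqP; ring.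
have -> : psi_err x * ln x + summatory (fun n => mangoldt R n * psi_err (x / n%:R)) x
   = S - (g + 1) * (ln x + psi x).
  rewrite SE /psi /summatory.
  under [X in _ = _ + X - _]eq_bigr do rewrite mulrDr.
  by rewrite big_split /= -mulr_suml; ring.
apply: (le_trans (ler_normB _ _)); rewrite [leRHS]mulrDl lerD // normrM -mulrA ler_wpM2l //.
have l0 : 0 <= ln x by rewrite ln_ge0.
have := ln_leB1 x0; have := psi_le (ltW x0); have := psi_ge0 x => *.
by rewrite ger0_norm; lra.
Qed.

Lemma sum_inv_sqr (R : realType) N :
  \sum_(1 <= k < N.+1) (k%:R ^+ 2)^-1 <= 2 :> R.
Proof.
case: N => [|N]; first by rewrite big_geq.
suff h : \sum_(1 <= k < N.+2) (k%:R ^+ 2)^-1 <= 2 - N.+1%:R^-1 :> R.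
  by rewrite (le_trans h) // gerBl invr_ge0.
elim: N => [|N IH]; first by rewrite big_nat1 expr1n invr1; lra.
rewrite big_nat_recr //= (le_trans (lerD IH (lexx _))) //.
set a : R := N.+1%:R; have -> : N.+2%:R = a + 1 :> R by rewrite natr1.
have a0 : 0 < a by rewrite ltr0n.
have -> : 2 - (a + 1)^-1 = 2 - a^-1 + (a * (a + 1))^-1.
  by field; rewrite !gt_eqF //; lra.
rewrite lerD2l lef_pV2 ?posrE ?exprn_gt0 ?mulr_gt0 //; nra.
Qed.

(** Bound [ln (x / n)] by a harmonic sum and exchange: the result is the sum of [psi (x / k) / k],
    at most [6 * x] times the sum of [1 / k ^ 2]. *)
Lemma sum_mangoldt_ln (R : realType) (x : R) : 1 <= x ->
  0 <= summatory (fun n => mangoldt R n * ln (x / n%:R)) x <= 12 * x.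
Proof.
move=> x1; have x0 : 0 < x by lra.
have [_ N1 N2] := truncn_bounds x1.
rewrite /summatory; set N := Num.truncn x in N1 N2 *.
have xn n : (1 <= n < N.+1)%N -> 1 <= x / n%:R.
  case/andP=> n1; rewrite ltnS => nN; have n0 : 0 < n%:R :> R by rewrite ltr0n.
  by rewrite ler_pdivlMr // mul1r (le_trans _ N1) // ler_nat.
apply/andP; split.
  rewrite big_nat; apply: sumr_ge0 => n /xn xn1.
  by rewrite mulr_ge0 ?mangoldt_ge0 // ln_ge0.
apply: (@le_trans _ _ (\sum_(1 <= n < N.+1) \sum_(1 <= k < (N %/ n).+1)
    mangoldt R n * k%:R^-1)).
  apply: ler_sum_nat => n nN; rewrite -mulr_sumr ler_wpM2l ?mangoldt_ge0 //.
  have [n0 _] := andP nN; rewrite -(truncn_divn (ltW x0) n0).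
  rewrite -/(harmonic_sum R _); apply: (le_trans _ (harmonic_sum_ge R _)).
  have x1' := xn _ nN; have [_ _ h] := truncn_bounds x1'.
  by rewrite ler_ln ?posrE -?natr1 ?(ltW h) //; lra.
rewrite sum_hyperbola_exchange.
apply: (@le_trans _ _ (\sum_(1 <= k < N.+1) 6 * x * (k%:R ^+ 2)^-1)).
  apply: ler_sum_nat => k /andP[k0 _]; rewrite -mulr_suml.
  have k0' : 0 < k%:R :> R by rewrite ltr0n.
  rewrite expr2 invfM mulrA ler_pM2r ?invr_gt0 //.
  have := @psi_le R (x / k%:R); rewrite /psi summatory_div ?(ltW x0) // mulrA.
  by apply; rewrite divr_ge0 ?ltW.
rewrite -mulr_sumr; have := sum_inv_sqr R N; nra.
Qed.

Definition selberg_weight (R : realType) (n : nat) : R :=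
  mangoldt R n * ln n%:R + dirichlet_conv (mangoldt R) (mangoldt R) n.

(** Passing from [mangoldt n * ln n] to [mangoldt n * ln x] costs [O(x)] by [sum_mangoldt_ln]. In
    the convolution, [psi (x / n)] is [x / n] plus the error controlled by [selberg_linear], and
    Mertens' estimate evaluates the main term. *)
Lemma selberg_formula (R : realType) : exists2 C : R, 0 <= C & forall x, 1 <= x ->
  `|summatory (selberg_weight R) x - 2 * (x * ln x)| <= C * x.
Proof.
have [C C0 hC] := selberg_linear R; exists (C + 22); first by lra.
move=> x x1; have x0 : 0 < x by lra.
have := hC x x1; have := mertens x1; have /andP[] := sum_mangoldt_ln x1.
set M := summatory (fun n => _ * ln _) x; set S := summatory (fun n => _ / _) x.
set T := summatory (fun n => _ * psi_err _) x => M0 M1.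
have TE : T = summatory (dirichlet_conv (mangoldt R) (mangoldt R)) x - x * S.
  rewrite /T /S /summatory mulr_sumr.
  under [X in _ = X - _]eq_bigr do rewrite -[dirichlet_conv _ _ _]mulr1.
  rewrite -(sum_dirichlet_conv _ _ (fun=> 1)) -sumrB.
  apply: eq_big_nat => n /andP[n0 _]; rewrite /psi_err /psi summatory_div ?ltW //.
  rewrite mulrBr mulrCA; congr (_ * _ - _).
  by apply: eq_bigr => m _; rewrite mulr1.
have WE : summatory (selberg_weight R) x = psi x * ln x - M +
    summatory (dirichlet_conv (mangoldt R) (mangoldt R)) x.
  rewrite /summatory big_split /=; congr (_ + _).
  rewrite /psi /M /summatory mulr_suml -sumrB.
  apply: eq_big_nat => n /andP[n0 _].
  by rewrite ln_div ?posrE ?ltr0n //; ring.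
have -> : summatory (selberg_weight R) x - 2 * (x * ln x) =
    (psi_err x * ln x + T) + (x * (S - ln x) - M).
  by rewrite WE TE /psi_err; ring.
move=> hS hT; apply: (le_trans (ler_normD _ _)).
rewrite [leRHS]mulrDl lerD //; apply: (le_trans (ler_normB _ _)).
rewrite normrM (gtr0_norm x0) (ger0_norm M0).
have := ler_wpM2l (ltW x0) hS; lra.
Qed.

Lemma selberg_weight_avg (R : realType) : exists2 C : R, 0 <= C & forall N : nat,
  `|\sum_(1 <= n < N.+1) (selberg_weight R n - 2 * ln n%:R)| <= C * N%:R.
Proof.
have [C C0 hC] := selberg_formula R; exists (C + 8); first by lra.
case=> [|N]; first by rewrite big_geq // normr0 mulr0.
set x : R := N.+1%:R; have x1 : 1 <= x by rewrite ler1n.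
have := hC x x1; rewrite /x summatory_nat sumrB -mulr_sumr sum_ln -/x.
have := @stirling R N.+1 isT; rewrite -/x.
have := @ln_leB1 R x; rewrite (lt_le_trans ltr01 x1) => /(_ isT).
have : 0 <= ln x by rewrite ln_ge0.
rewrite !ler_norml => l0 l1 /andP[h1 h2] /andP[k1 k2]; apply/andP; split; lra.
Qed.

(** Multiply the linear relation by [ln x], split [ln x = ln (x / n) + ln n], and use the relation
    again at each [x / n]. The terms in [mangoldt n * ln n] and in the convolution appear with
    opposite signs; absolute values make their weights add up to [selberg_weight]. *)
Lemma psi_err_ln2 (R : realType) : exists2 C : R, 0 <= C & forall x, 1 <= x ->
  `|psi_err x| * ln x ^+ 2 <=
  summatory (fun n => selberg_weight R n * `|psi_err (x / n%:R)|) x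
  + C * (x * (1 + ln x)).
Proof.
have [C C0 hC] := selberg_linear R; exists (11 * C); first by rewrite mulr_ge0.
move=> x x1; have x0 : 0 < x by lra.
have l0 : 0 <= ln x by rewrite ln_ge0.
pose E y := psi_err y * ln y + summatory (fun n => mangoldt R n * psi_err (y / n%:R)) y.
have hE y : 1 <= y -> `|E y| <= C * y := hC y.
set N := Num.truncn x.
pose L n : R := mangoldt R n.
pose r n := psi_err (x / n%:R).
have rr n m : (0 < n)%N -> psi_err (x / n%:R / m%:R) = r (n * m)%N.
  by move=> n0; rewrite /r natrM invfM mulrA.
have xn n : (1 <= n < N.+1)%N -> 1 <= x / n%:R.
  case/andP=> n1; rewrite ltnS => nN; have n0 : 0 < n%:R :> R by rewrite ltr0n.
  by rewrite ler_pdivlMr // mul1r -truncn_ge_nat ?ltW.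
have key : psi_err x * ln x ^+ 2 = E x * ln x - \sum_(1 <= n < N.+1) L n * E (x / n%:R)
   - \sum_(1 <= n < N.+1) L n * ln n%:R * r n
   + \sum_(1 <= n < N.+1) dirichlet_conv (mangoldt R) (mangoldt R) n * r n.
  rewrite -sum_dirichlet_conv.
  have -> : psi_err x * ln x ^+ 2 = E x * ln x - \sum_(1 <= n < N.+1) L n * r n * ln x.
    by rewrite -mulr_suml /E /summatory -/N /r /L; ring.
  rewrite -!addrA; congr (_ + _); rewrite -!sumrN -!big_split /=.
  apply: eq_big_nat => n nN; have [n0 _] := andP nN.
  have n0' : 0 < n%:R :> R by rewrite ltr0n.
  rewrite /E summatory_div ?ltW // ln_div ?posrE //.
  under [X in _ = - (_ * (_ + X)) + _]eq_bigr do rewrite rr //.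
  by rewrite /L /r; ring.
have h1 : `|E x * ln x| <= C * (x * (1 + ln x)).
  rewrite normrM (ger0_norm l0).
  have := ler_wpM2r l0 (hE _ x1); have := mulr_ge0 C0 (ltW x0); lra.
have h2 : `|\sum_(1 <= n < N.+1) L n * E (x / n%:R)| <= 10 * C * (x * (1 + ln x)).
  apply: (le_trans (ler_norm_sum _ _ _)).
  apply: (@le_trans _ _ (\sum_(1 <= n < N.+1) C * x * (L n / n%:R))).
    apply: ler_sum_nat => n nN; rewrite normrM ger0_norm ?mangoldt_ge0 //.
    have := ler_wpM2l (mangoldt_ge0 R n) (hE _ (xn _ nN)).
    by move/le_trans; apply; rewrite /L le_eqVlt; apply/orP; left; apply/eqP; ring.
  rewrite -mulr_sumr; have := mertens x1; rewrite /summatory -/N /L ler_norml.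
  case/andP=> _ m1; rewrite [10 * C]mulrC -!mulrA ler_wpM2l // mulrCA ler_wpM2l ?(ltW x0) //.
  by lra.
have h3 : `|\sum_(1 <= n < N.+1) L n * ln n%:R * r n| <=
    \sum_(1 <= n < N.+1) L n * ln n%:R * `|r n|.
  apply: (le_trans (ler_norm_sum _ _ _)); apply: ler_sum_nat => n /andP[n0 _].
  by rewrite normrM (@ger0_norm _ (_ * _)) // mulr_ge0 ?mangoldt_ge0 // ln_ge0 // ler1n.
have h4 : `|\sum_(1 <= n < N.+1) dirichlet_conv (mangoldt R) (mangoldt R) n * r n| <=
    \sum_(1 <= n < N.+1) dirichlet_conv (mangoldt R) (mangoldt R) n * `|r n|.
  apply: (le_trans (ler_norm_sum _ _ _)); apply: ler_sum_nat => n /andP[n0 _].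
  rewrite normrM ger0_norm //; apply: sumr_ge0 => d _.
  by rewrite mulr_ge0 ?mangoldt_ge0.
have -> : summatory (fun n => selberg_weight R n * `|psi_err (x / n%:R)|) x =
    \sum_(1 <= n < N.+1) L n * ln n%:R * `|r n| +
    \sum_(1 <= n < N.+1) dirichlet_conv (mangoldt R) (mangoldt R) n * `|r n|.
  by rewrite -big_split /=; apply: eq_bigr => n _; rewrite mulrDl.
have -> : `|psi_err x| * ln x ^+ 2 = `|psi_err x * ln x ^+ 2|.
  by rewrite normrM (@ger0_norm _ (_ ^+ 2)) // sqr_ge0.
rewrite key; move: h1 h2 h3 h4.
set a := E x * _; set b := \sum_(1 <= n < N.+1) _ * E _.
set c := \sum_(1 <= n < N.+1) L n * ln _ * r _.
set d := \sum_(1 <= n < N.+1) _ * r _ => h1 h2 h3 h4.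
have := ler_normD (a - b - c) d; have := ler_normB (a - b) c; have := ler_normB a b.
lra.
Qed.

Lemma abel_summation (R : comNzRingType) (e f : nat -> R) N :
  \sum_(1 <= n < N.+1) e n * f n =
  (\sum_(1 <= k < N.+1) e k) * f N.+1 +
  \sum_(1 <= n < N.+1) (\sum_(1 <= k < n.+1) e k) * (f n - f n.+1).
Proof.
elim: N => [|N IH]; first by rewrite !big_geq // mul0r addr0.
rewrite big_nat_recr //= IH [in RHS]big_nat_recr //= [\sum_(1 <= n < N.+2) _ * _]big_nat_recr //=.
by rewrite [\sum_(1 <= k < N.+2) _]big_nat_recr //=; ring.
Qed.

(** Only the variation of [f] matters, and that of [g] dominates it. A second Abel summation, with
    all coefficients 1, turns the sum of [n * (g n - g n.+1)] back into the sum of [g]. *)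
Lemma abel_error_bound (R : realType) (C : R) (e f g : nat -> R) N : 0 <= C ->
  (forall n, `|\sum_(1 <= k < n.+1) e k| <= C * n%:R) ->
  (forall n, (0 < n)%N -> `|f n - f n.+1| <= g n - g n.+1) ->
  0 <= g N.+1 ->
  `|\sum_(1 <= n < N.+1) e n * f n| <=
  C * N%:R * `|f N.+1| + C * \sum_(1 <= n < N.+1) g n.
Proof.
move=> C0 hE hf g0; rewrite abel_summation (le_trans (ler_normD _ _)) // lerD //.
  by rewrite normrM ler_wpM2r.
have -> : \sum_(1 <= n < N.+1) g n =
    N%:R * g N.+1 + \sum_(1 <= n < N.+1) n%:R * (g n - g n.+1).
  have := abel_summation (fun=> 1) g N.
  under eq_bigr do rewrite mul1r; move=> ->; rewrite sumr_const_nat subn1 /=.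
  by congr (_ + _); apply: eq_bigr => n _; rewrite sumr_const_nat subn1.
rewrite mulrDr (le_trans (ler_norm_sum _ _ _)) //.
rewrite (@le_trans _ _ (C * \sum_(1 <= n < N.+1) n%:R * (g n - g n.+1))) //.
  rewrite mulr_sumr; apply: ler_sum_nat => n /andP[n0 _].
  by rewrite normrM mulrA ler_pM // hf.
by rewrite lerDr !mulr_ge0.
Qed.

(** By Selberg's formula the weight is [2 * ln n] on average. The replacement is legitimate because
    the variation of [|psi_err (x / n)|] in [n] is dominated by that of the decreasing function
    [psi (x / n) + x / n], whose sum is [O(x * (1 + ln x))]. *)
Lemma psi_err_ln2_avg (R : realType) : exists2 C : R, 0 <= C & forall x, 1 <= x ->
  `|psi_err x| * ln x ^+ 2 <=
  2 * summatory (fun n => ln n%:R * `|psi_err (x / n%:R)|) x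
  + C * (x * (1 + ln x)).
Proof.
have [C C0 hC] := psi_err_ln2 R; have [D D0 hD] := selberg_weight_avg R.
exists (C + 9 * D); first by lra.
move=> x x1; have x0 : 0 < x by lra.
have l0 : 0 <= ln x by rewrite ln_ge0.
apply: (le_trans (hC x x1)).
pose f n := `|psi_err (x / n%:R)|; pose g n : R := psi (x / n%:R) + x / n%:R.
rewrite /summatory; set N := Num.truncn x.
have hf n : (0 < n)%N -> `|f n - f n.+1| <= g n - g n.+1.
  move=> n0; apply: (le_trans (ler_dist_dist _ _)).
  have n0' : 0 < n%:R :> R by rewrite ltr0n.
  have le1 : x / n.+1%:R <= x / n%:R.
    by rewrite ler_pM2l // lef_pV2 ?posrE ?ltr0n // ler_nat.
  have le2 := ler_psi le1.
  rewrite /psi_err /g ler_norml; move: le1 le2.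
  by move: (x / n.+1%:R) (x / n%:R) => u v le1 le2; apply/andP; split; lra.
have g0 n : 0 <= g n by rewrite addr_ge0 ?psi_ge0 // divr_ge0 // ltW.
have := abel_error_bound D0 hD hf (g0 N.+1).
have gE : \sum_(1 <= n < N.+1) g n <= 2 * (x * (1 + ln x)).
  rewrite big_split /= -mulr_sumr -/(harmonic_sum _ _).
  have := ln_fact_psi (ltW x0); rewrite /summatory -/N => <-.
  have [N1 Nx _] := truncn_bounds x1; rewrite -/N in N1 Nx.
  have N0 : 0 < N%:R :> R by lra.
  have N0' : (0 < N)%N by rewrite truncn_gt0.
  have lN : ln N%:R <= ln x by rewrite ler_ln ?posrE.
  have k1 : ln (N`!)%:R <= x * ln x.
    rewrite -sum_ln (@le_trans _ _ (\sum_(1 <= n < N.+1) ln x)) //.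
      apply: ler_sum_nat => n /andP[n0 nN]; rewrite ler_ln ?posrE ?ltr0n //.
      by rewrite (le_trans _ Nx) // ler_nat.
    by rewrite sumr_const_nat subn1 -mulr_natl ler_wpM2r.
  have k2 : x * harmonic_sum R N <= x * (1 + ln x).
    by rewrite ler_pM2l // (le_trans (harmonic_sum_le R N0')) // lerD2l.
  by lra.
have fE : N%:R * `|f N.+1| <= 7 * x.
  rewrite /f normr_id.
  have xN0 : 0 <= x / N.+1%:R by rewrite divr_ge0 ?ltW.
  apply: (le_trans (ler_wpM2l (ler0n _ _) (psi_err_le xN0))).
  rewrite mulrCA ler_wpM2l // mulrCA ler_piMr ?(ltW x0) // ler_pdivrMr ?ltr0n // mul1r ler_nat.
  exact: leqnSn.
have -> : \sum_(1 <= n < N.+1) selberg_weight R n * `|psi_err (x / n%:R)| =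
  2 * (\sum_(1 <= n < N.+1) ln n%:R * f n) +
  \sum_(1 <= n < N.+1) (selberg_weight R n - 2 * ln n%:R) * f n.
  by rewrite mulr_sumr -big_split /=; apply: eq_bigr => n _; rewrite /f; ring.
move=> hh; have := ler_norm (\sum_(1 <= n < N.+1) (selberg_weight R n - 2 * ln n%:R) * f n).
have := ler_wpM2l D0 fE; have := ler_wpM2l D0 gE; rewrite -mulrA in hh.
have := mulr_ge0 D0 (mulr_ge0 (ltW x0) l0).
rewrite -/f; lra.
Qed.

Lemma sum_nat_leq (R : realType) (A M : nat) :
  \sum_(1 <= n < M.+1) (n <= A)%N%:R = (minn A M)%:R :> R.
Proof.
elim: M => [|M IH]; first by rewrite big_geq // minn0.
rewrite big_nat_recr //= IH -natrD; congr (_%:R).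
by case: (leqP M.+1 A) => /=; lia.
Qed.

(** Hyperbola method with [B = N %/ A]: each [m <= B] is counted for all [A] values of [n], each
    larger [m] for [N %/ m] of them. By Mertens the second range gives [N * ln (N / B)] up to
    [O(N)], which cancels [x] times the harmonic sum up to [A]. *)
Lemma sum_psi_err_le (R : realType) : exists2 C : R, 0 < C & forall x A, 1 <= x ->
  (A <= Num.truncn x)%N -> `|\sum_(1 <= n < A.+1) psi_err (x / n%:R)| <= C * x.
Proof.
exists 40 => // x A x1; have x0 : 0 < x by lra.
case: A => [|A']; first by rewrite big_geq // normr0 => _; lra.
set A := A'.+1; have [N1 Nx xN] := truncn_bounds x1.
set N := Num.truncn x in N1 Nx xN * => AN.
have A0 : 0 < A%:R :> R by rewrite ltr0n.
set B := (N %/ A)%N; have B0 : (0 < B)%N by rewrite divn_gt0.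
have BN : (B <= N)%N by rewrite leq_div.
pose L n : R := mangoldt R n.
have E1 : \sum_(1 <= n < A.+1) psi (x / n%:R) =
    A%:R * psi B%:R + \sum_(B.+1 <= m < N.+1) L m * (N %/ m)%:R.
  transitivity (\sum_(1 <= n < N.+1) \sum_(1 <= m < (N %/ n).+1) (n <= A)%N%:R * L m).
    rewrite (big_cat_nat _ (n := A.+1) (p := N.+1)) //= [X in _ + X]big_nat.
    rewrite [X in _ + X]big1 ?addr0 => [|n /andP[n1 _]]; last first.
      by rewrite big1 // => m _; rewrite leqNgt n1 mul0r.
    apply: eq_big_nat => n /andP[n0 nA]; rewrite /psi summatory_div ?ltW //.
    by apply: eq_bigr => m _; rewrite -ltnS nA mul1r.
  rewrite sum_hyperbola_exchange.
  under eq_bigr do rewrite -mulr_suml sum_nat_leq.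
  rewrite (big_cat_nat _ (n := B.+1) (p := N.+1)) //=; congr (_ + _).
    rewrite /psi summatory_nat mulr_sumr; apply: eq_big_nat => m /andP[m0].
    rewrite ltnS leq_divRL // mulnC => mB; congr (_%:R * _); apply/minn_idPl.
    by rewrite leq_divRL.
  apply: eq_big_nat => m /andP[m1 _]; rewrite mulrC; congr (_ * _%:R).
  have m0 : (0 < m)%N by apply: leq_trans m1.
  apply/minn_idPr; rewrite ltn_divLR // mulnC in m1.
  by apply: ltnW; rewrite ltn_divLR.
pose S M : R := \sum_(1 <= m < M.+1) L m / m%:R.
have SE : \sum_(B.+1 <= m < N.+1) L m / m%:R = S N - S B.
  by rewrite /S (big_cat_nat _ (m := 1%N) (n := B.+1) (p := N.+1)) //= addrC addrK.
have mert M : (0 < M)%N -> `|S M - ln M%:R| <= 10.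
  by move=> M0; have := @mertens R M%:R; rewrite ler1n summatory_nat => /(_ M0).
have N0' : (0 < N)%N by rewrite truncn_gt0.
have U : \sum_(B.+1 <= m < N.+1) L m * (N %/ m)%:R <= N%:R * (S N - S B).
  rewrite -SE mulr_sumr; apply: ler_sum_nat => d /andP[d0 _].
  have d0' : (0 < d)%N by apply: leq_trans d0.
  rewrite mulrCA ler_wpM2l ?mangoldt_ge0 // ler_pdivlMr ?ltr0n // -natrM ler_nat.
  exact: leq_divM.
have D : N%:R * (S N - S B) - psi N%:R <= \sum_(B.+1 <= m < N.+1) L m * (N %/ m)%:R.
  have le : \sum_(B.+1 <= m < N.+1) L m <= psi N%:R.
    rewrite /psi summatory_nat [leRHS](big_cat_nat _ (n := B.+1)) //= lerDr.
    by apply: sumr_ge0 => i _; rewrite mangoldt_ge0.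
  rewrite lerBlDr (le_trans _ (lerD (lexx _) le)) //.
  rewrite -SE mulr_sumr -big_split /=; apply: ler_sum_nat => d /andP[d0 _].
  have d0' : (0 < d)%N by apply: leq_trans d0.
  rewrite mulrCA -{3}[L d]mulr1 -mulrDr ler_wpM2l ?mangoldt_ge0 //.
  by rewrite natr1 ler_pdivrMr ?ltr0n // -natrM ler_nat ltnW // ltn_ceil.
have pN := psi_nat_le R N.
have pB : A%:R * psi (B%:R : R) <= 6 * N%:R.
  apply: (le_trans (ler_wpM2l (ler0n _ _) (psi_nat_le R B))).
  rewrite mulrCA ler_wpM2l // -natrM ler_nat mulnC; exact: leq_divM.
have pB0 : 0 <= A%:R * psi (B%:R : R) by rewrite mulr_ge0 ?psi_ge0.
have B0' : 0 < B%:R :> R by rewrite ltr0n.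
have N0 : 0 < N%:R :> R by lra.
have lnAB : 0 <= ln N%:R - ln A%:R - ln (B%:R : R) <= 1.
  rewrite -addrA -opprD -lnM ?posrE //; apply/andP; split.
    by rewrite subr_ge0 ler_ln ?posrE ?mulr_gt0 // -natrM ler_nat mulnC leq_divM.
  have ab : 0 < A%:R * B%:R :> R by rewrite mulr_gt0.
  rewrite (le_trans (lnB_le ab N0)) // ler_pdivrMr // mul1r lerBlDr -natrM -natrD ler_nat.
  have h1 : (N < B.+1 * A)%N by apply: ltn_ceil.
  have h2 : (A <= A * B)%N by rewrite leq_pmulr.
  have h3 : (B.+1 * A = A + A * B)%N by rewrite mulSn mulnC.
  by rewrite h3 in h1; apply: leq_trans (ltnW h1) _; rewrite leq_add2r.
have := mert _ N0'; have := mert _ B0; rewrite !ler_norml => /andP[b1 b2] /andP[n1 n2].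
have Ap : (0 < A)%N by [].
have H1 := harmonic_sum_le R Ap.
have H2 : ln A%:R <= harmonic_sum R A.
  by rewrite (le_trans _ (harmonic_sum_ge R A)) // ler_ln ?posrE ?ltr0n // ler_nat.
have l1 := ln_leB1 A0.
have AN' : A%:R <= N%:R :> R by rewrite ler_nat.
have lA0 : 0 <= ln A%:R :> R by rewrite ln_ge0 // ler1n.
have E2 : \sum_(1 <= n < A.+1) psi_err (x / n%:R) =
   A%:R * psi B%:R + \sum_(B.+1 <= m < N.+1) L m * (N %/ m)%:R
   - N%:R * harmonic_sum R A - (x - N%:R) * harmonic_sum R A.
  by rewrite -E1 /psi_err sumrB -mulr_sumr -/(harmonic_sum _ _); ring.
rewrite E2; case/andP: lnAB => a1 a2.
set H := harmonic_sum R A in H1 H2 *.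
have q1 : N%:R * (S N - S B - H) <= N%:R * 21 by rewrite ler_pM2l //; lra.
have q2 : N%:R * (- 21) <= N%:R * (S N - S B - H) by rewrite ler_pM2l //; lra.
have q3 : 0 <= (x - N%:R) * H by rewrite mulr_ge0 //; lra.
have q4 : (x - N%:R) * H <= H by rewrite ler_piMl //; lra.
by apply/andP; split; lra.
Qed.

(** * The prime number theorem *)

Lemma ler_sum_subrange (R : numDomainType) (P : pred nat) (f : nat -> R) m p q n :
  (m <= p)%N -> (p <= q)%N -> (q <= n)%N -> (forall i, 0 <= f i) ->
  \sum_(p <= i < q | P i) f i <= \sum_(m <= i < n | P i) f i.
Proof.
move=> mp pq qn f0; rewrite (big_cat_nat _ (m := m) (n := p) (p := n)) //=; last first.
  exact: leq_trans qn.
rewrite [X in _ + X](big_cat_nat _ (n := q)) //= addrCA.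
by rewrite lerDl addr_ge0 // sumr_ge0.
Qed.

Lemma harmonic_block (R : realType) (k A : nat) : (0 < A)%N -> (0 < k)%N ->
  ln (k%:R : R) - 1 <= \sum_(A.+1 <= n < (k * A).+1) n%:R^-1.
Proof.
move=> A0 k0; have kA0 : (0 < k * A)%N by rewrite muln_gt0 k0.
have -> : \sum_(A.+1 <= n < (k * A).+1) n%:R^-1 = harmonic_sum R (k * A) - harmonic_sum R A.
  rewrite /harmonic_sum (big_cat_nat _ (m := 1%N) (n := A.+1) (p := (k * A).+1)) //=.
    by rewrite addrC addrK.
  by rewrite ltnS leq_pmull.
have h1 := harmonic_sum_le R A0.
have h2 : ln (k * A)%:R <= harmonic_sum R (k * A).
  by rewrite (le_trans _ (harmonic_sum_ge R _)) // ler_ln ?posrE ?ltr0n // ler_nat.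
rewrite natrM lnM ?posrE ?ltr0n // in h2; lra.
Qed.

(* If a function of average zero stays above [- b] in the scale [x / n], it can only
   exceed [b] on part of the block. *)
Lemma one_sided_block (R : realType) (C b x : R) (r : nat -> R) (p q : nat) :
  0 < b -> 0 < x -> (p <= q)%N ->
  \sum_(p.+1 <= n < q.+1) r n <= 2 * C * x ->
  2 * C / b + 2 <= \sum_(p.+1 <= n < q.+1) n%:R^-1 ->
  (forall n, (p < n <= q)%N -> - (b * (x / n%:R)) <= r n) ->
  (1 : R) <= \sum_(p.+1 <= n < q.+1 | `|r n| <= b * (x / n%:R)) n%:R^-1.
Proof.
move=> b0 x0 pq rC hl hr.
(* Termwise, [r n] is at least [b * x / n] off the good set and at least [- b * x / n] on it, hence
   the factor 2. *)
have key : b * x * (\sum_(p.+1 <= n < q.+1) n%:R^-1 -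
    2 * \sum_(p.+1 <= n < q.+1 | `|r n| <= b * (x / n%:R)) n%:R^-1) <=
    \sum_(p.+1 <= n < q.+1) r n.
  rewrite [X in 2 * X]big_mkcond mulr_sumr -sumrB mulr_sumr.
  apply: ler_sum_nat => n /andP[n0 nq].
  have := hr n; rewrite n0 -ltnS nq => /(_ isT); rewrite mulrA.
  case: ifP => [|/negbT]; rewrite ler_norml => h hn.
    by case/andP: h; lra.
  have n0' : 0 <= b * x / n%:R by rewrite divr_ge0 // mulr_ge0 // ltW.
  by move: h; rewrite negb_and -!ltNge => /orP[]; lra.
have := le_trans key rC; move: hl; set l := \sum_(p.+1 <= n < q.+1) _ => hl.
rewrite [2 * C * x]mulrC [b * x]mulrC -mulrA ler_pM2l // -ler_pdivlMl // [b^-1 * _]mulrC.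
by move: (\sum_(p.+1 <= n < q.+1 | _) _) => e; lra.
Qed.

(** As the argument falls from [x / s] to [x / n], [psi] does not increase, so [psi_err] rises by at
    most [x / s - x / n <= b * (x / n)]. *)
Lemma slow_crossing (R : realType) (b x : R) (s n : nat) : 0 < b -> 0 < x ->
  (0 < s)%N -> (s <= n)%N -> n%:R <= (1 + b) * s%:R ->
  psi_err (x / s%:R) <= - (b * (x / s%:R)) -> psi_err (x / n%:R) <= b * (x / n%:R).
Proof.
move=> b0 x0 s0 sn nb; have s0' : 0 < s%:R :> R by rewrite ltr0n.
have n0' : 0 < n%:R :> R by rewrite ltr0n (leq_trans s0).
have le1 : x / n%:R <= x / s%:R by rewrite ler_pM2l // lef_pV2 ?posrE // ler_nat.
have := ler_psi le1; rewrite /psi_err.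
have h : x / s%:R <= (1 + b) * (x / n%:R).
  rewrite ler_pdivrMr // (_ : _ * s%:R = x * ((1 + b) * s%:R / n%:R)); last by ring.
  by rewrite ler_peMr ?(ltW x0) // ler_pdivlMr // mul1r.
have : 0 <= b * (x / s%:R) by rewrite mulr_ge0 ?(ltW b0) // divr_ge0 // ltW.
move: h; move: (x / s%:R) (x / n%:R) => u v; nra.
Qed.

(** Let [s] be the last index before [n2] at which the error is at most [- b * (x / s)]. From [s] up
    to [(1 + b) * s] the error is small: maximality bounds it below, [slow_crossing] above. The
    latter also shows that [n2] lies beyond this stretch. *)
Lemma crossing_block (R : realType) (b x : R) (n1 n2 : nat) : 0 < b -> 0 < x ->
  (0 < n1)%N -> 2 <= b * n1%:R -> (n1 < n2)%N ->
  psi_err (x / n1%:R) <= - (b * (x / n1%:R)) -> b * (x / n2%:R) < psi_err (x / n2%:R) ->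
  b / (2 * (1 + b)) <=
  \sum_(n1.+1 <= n < n2 | `|psi_err (x / n%:R)| <= b * (x / n%:R)) n%:R^-1.
Proof.
move=> b0 x0 n10 bn1 n12 h1 h2.
pose P n := [&& (n1 <= n)%N, (n < n2)%N & psi_err (x / n%:R) <= - (b * (x / n%:R))].
have exP : exists n, P n by exists n1; rewrite /P leqnn n12 h1.
have ubP n : P n -> (n <= n2)%N by case/and3P=> _ /ltnW.
have [s /and3P[s1 s2 hs] smax] := ex_maxnP exP ubP.
have s0 : (0 < s)%N by apply: leq_trans s1.
have s0' : 0 < s%:R :> R by rewrite ltr0n.
have bs : 2 <= b * s%:R by rewrite (le_trans bn1) // ler_pM2l // ler_nat.
set M := Num.truncn ((1 + b) * s%:R).
have m0 : 0 <= (1 + b) * s%:R by rewrite mulr_ge0 ?ltW //; lra.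
have /andP[M1 M2] := truncn_itv m0; rewrite -/M in M1 M2.
have sM : (s < M)%N by rewrite /M truncn_gt_nat -natr1; lra.
have Mn2 : (M < n2)%N.
  rewrite ltnNge; apply/negP => nM.
  have : n2%:R <= (1 + b) * s%:R by rewrite (le_trans _ M1) // ler_nat.
  by move=> /(slow_crossing b0 x0 s0 (ltnW s2))/(_ hs); rewrite leNgt h2.
rewrite (@le_trans _ _ (\sum_(s.+1 <= n < M.+1 | `|psi_err (x / n%:R)| <= b * (x / n%:R))
    n%:R^-1)) //; last first.
  by apply: ler_sum_subrange => //; rewrite ltnS // ltnW.
(* There are [M - s] terms, each at least [1 / M]. Since [b * s >= 2], rounding loses at most half
   of the length [b * s], which explains the 2 in the denominator. *)
rewrite big_mkcond (@le_trans _ _ (\sum_(s.+1 <= n < M.+1) M%:R^-1)) //.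
  rewrite sumr_const_nat subSS -[leRHS]mulr_natr natrB ?(ltnW sM) //.
  have M0 : 0 < M%:R :> R by rewrite ltr0n (leq_ltn_trans _ sM).
  rewrite [leRHS]mulrC ler_pdivlMr // mulrAC ler_pdivrMr; last by lra.
  have := ler_wpM2l (ltW b0) M1; rewrite -natr1 in M2; nra.
apply: ler_sum_nat => n /andP[sn nM].
rewrite ifT; last first.
  rewrite ler_norml; apply/andP; split; last first.
    apply: (slow_crossing b0 x0 s0 (ltnW sn) _ hs).
    by rewrite (le_trans _ M1) // ler_nat -ltnS.
  rewrite leNgt; apply/negP => /ltW hn.
  have : P n by rewrite /P (leq_trans s1 (ltnW sn)) (leq_ltn_trans _ Mn2) // -ltnS.
  by move/smax; rewrite leqNgt sn.
have n0 : (0 < n)%N := leq_ltn_trans (leq0n s) sn.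
have M0 : (0 < M)%N := leq_ltn_trans (leq0n s) sM.
by rewrite lef_pV2 ?posrE ?ltr0n // ler_nat -ltnS.
Qed.

(** Consider the blocks from [A] to [k * A] and from [k * A] to [k * k * A]. If the error never
    falls below [- b] in scale on the first, or never exceeds [b] on the second, [one_sided_block]
    applies. Otherwise a low point precedes a high point, and [crossing_block] applies. *)
Lemma small_psi_err_block (R : realType) (b : R) : 0 < b ->
  exists K A0 : nat, exists2 eta : R, 0 < eta & (1 < K)%N /\
  forall (x : R) (A : nat), 1 <= x -> (A0 <= A)%N -> (A * K <= Num.truncn x)%N ->
  eta <= \sum_(A.+1 <= n < (A * K).+1 | `|psi_err (x / n%:R)| <= b * (x / n%:R)) n%:R^-1.
Proof.
move=> b0; have [C C0 hC] := sum_psi_err_le R.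
(* Chosen so that each block has logarithmic mass at least [ln k - 1 >= 2 * C / b + 2]; [A1] ensures
   [b * A >= 2]. *)
pose k := (Num.truncn (expR (2 * C / b + 3))).+1.
pose A1 := (Num.truncn (2 / b)).+1.
have k1 : 2 * C / b + 3 <= ln (k%:R : R).
  rewrite -ler_expR lnK ?posrE ?ltr0n //; apply: ltW.
  by rewrite /k; case/andP: (truncn_itv (expR_ge0 (2 * C / b + 3))).
have cb : 0 < 2 * C / b by rewrite divr_gt0 // mulr_gt0.
have kgt : (1 < k)%N.
  rewrite ltnNge; apply/negP => k1'; have kE : k = 1%N by apply/eqP; rewrite eqn_leq k1'.
  by rewrite kE ln1 in k1; lra.
have k0 : (0 < k)%N by apply: ltnW.
pose eta := Num.min 1 (b / (2 * (1 + b))).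
have eta0 : 0 < eta.
  by rewrite /eta lt_min ltr01 divr_gt0 // mulr_gt0 //; lra.
exists (k * k)%N, A1, eta => //; split=> [|x A x1 A1A AK].
  by rewrite (leq_trans kgt) // leq_pmull.
have x0 : 0 < x by lra.
have A0 : (0 < A)%N by apply: leq_trans A1A.
have bA : 2 <= b * A%:R.
  rewrite mulrC -ler_pdivrMr // ltW //.
  have /andP[_ h] := truncn_itv (ltW (divr_gt0 (ltr0n _ 2 : 0 < 2%:R :> R) b0)).
  by rewrite (lt_le_trans h) // ler_nat.
pose r n := psi_err (x / n%:R).
have A_kA : (A <= k * A)%N by rewrite leq_pmull.
have kA_kkA : (k * A <= A * (k * k))%N by rewrite mulnC leq_mul2l leq_pmull ?orbT.
have block p q : (p <= q)%N -> (q <= A * (k * k))%N ->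
    `|\sum_(p.+1 <= n < q.+1) r n| <= 2 * C * x.
  move=> pq qA; have qx := leq_trans qA AK.
  have -> : \sum_(p.+1 <= n < q.+1) r n =
      \sum_(1 <= n < q.+1) r n - \sum_(1 <= n < p.+1) r n.
    by rewrite (big_cat_nat _ (m := 1%N) (n := p.+1) (p := q.+1)) //= addrC addrK.
  have := hC x q x1 qx; have := hC x p x1 (leq_trans pq qx).
  rewrite -/r; set u := \sum_(1 <= n < p.+1) _; set v := \sum_(1 <= n < q.+1) _ => h1 h2.
  by have := ler_normB v u; lra.
have hl1 : 2 * C / b + 2 <= \sum_(A.+1 <= n < (k * A).+1) n%:R^-1.
  by have := harmonic_block R A0 k0; lra.
have hl2 : 2 * C / b + 2 <= \sum_((k * A).+1 <= n < (A * (k * k)).+1) n%:R^-1.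
  have kA0 : (0 < k * A)%N by rewrite muln_gt0 k0.
  have -> : (A * (k * k) = k * (k * A))%N by rewrite mulnC -mulnA.
  by have := harmonic_block R kA0 k0; lra.
have eta1 : eta <= 1 by rewrite /eta ge_min lexx.
case: (pselect (forall n, (A < n <= k * A)%N -> - (b * (x / n%:R)) <= r n)) => [H1|].
  apply: (le_trans eta1).
  have := one_sided_block b0 x0 A_kA _ hl1 H1.
  move/(_ (le_trans (ler_norm _) (block _ _ A_kA kA_kkA))) => /le_trans; apply.
  by apply: ler_sum_subrange.
case: (pselect (forall n, (k * A < n <= A * (k * k))%N -> r n <= b * (x / n%:R))) => [H2 _|].
  apply: (le_trans eta1).
  have H2' n : (k * A < n <= A * (k * k))%N -> - (b * (x / n%:R)) <= - r n.
    by move=> h; rewrite lerN2 H2.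
  have hs : \sum_((k * A).+1 <= n < (A * (k * k)).+1) - r n <= 2 * C * x.
    by rewrite sumrN (le_trans (ler_norm _)) // normrN block.
  have := one_sided_block b0 x0 kA_kkA hs hl2 H2'.
  under eq_bigl do rewrite normrN.
  by move=> /le_trans; apply; apply: ler_sum_subrange.
move=> /existsNP[n2 /not_implyP[/andP[n2a n2b] /negP]]; rewrite -ltNge => hn2.
move=> /existsNP[n1 /not_implyP[/andP[n1a n1b] /negP]]; rewrite -ltNge => hn1.
have n10 : (0 < n1)%N by apply: leq_ltn_trans n1a.
have bn1 : 2 <= b * n1%:R by rewrite (le_trans bA) // ler_pM2l // ler_nat ltnW.
have n12 : (n1 < n2)%N by apply: leq_ltn_trans n2a.
have := crossing_block b0 x0 n10 bn1 n12 (ltW hn1) hn2.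
have eta2 : eta <= b / (2 * (1 + b)) by rewrite /eta ge_min lexx orbT.
move=> /(le_trans eta2)/le_trans; apply.
by apply: ler_sum_subrange => //; [exact: ltnW | exact: leqW].
Qed.

Lemma sum_ln_div (R : realType) M : (0 < M)%N ->
  \sum_(1 <= n < M.+1) ln (n%:R : R) / n%:R <= ln M%:R ^+ 2 / 2 + ln M%:R.
Proof.
case: M => // M _; elim: M => [|M IH].
  by rewrite big_nat1 ln1 mul0r expr2 mul0r mul0r addr0.
rewrite big_nat_recr //= (le_trans (lerD IH (lexx _))) //.
set a : R := M.+1%:R; have -> : M.+2%:R = a + 1 :> R by rewrite natr1.
have a1 : 1 <= a by rewrite ler1n.
have a0 : 0 < a by lra.
have b0 : 0 < a + 1 by lra.
have := lnB_le a0 b0; have := lnB_ge a0 b0; rewrite addrAC subrr add0r !div1r.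
have la : 0 <= ln a by rewrite ln_ge0.
have : a^-1 <= 1 by rewrite invf_le1.
have : 0 <= (a + 1)^-1 by rewrite invr_ge0 ltW.
move: (a + 1)^-1 (a^-1) (ln a) (ln (a + 1)) la => i j l l' l0 i0 h1 h2 h3.
have : l' * i <= l' * (l' - l) by rewrite ler_wpM2l //; lra.
have : 0 <= (l' - l) * (1 - (l' - l)) by rewrite mulr_ge0; lra.
lra.
Qed.

Lemma sum_nat_range_ge j0 J : (j0 <= J)%N ->
  (J * J <= 2 * (\sum_(j0 <= j < J) j) + j0 * j0 + J)%N.
Proof.
elim: J => [|J IH]; first by rewrite leqn0 => /eqP ->.
rewrite leq_eqVlt ltnS => /orP[/eqP ->|h]; first by rewrite big_geq // muln0; lia.
rewrite big_nat_recr //=; have := IH h; move: (\sum_(j0 <= j < J) j)%N => s; nia.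
Qed.

Lemma sum_geometric_blocks (R : nmodType) (P : pred nat) (f : nat -> R) K j0 J :
  (1 < K)%N -> (j0 <= J)%N ->
  \sum_((K ^ j0).+1 <= n < (K ^ J).+1 | P n) f n =
  \sum_(j0 <= j < J) \sum_((K ^ j).+1 <= n < (K ^ j * K).+1 | P n) f n.
Proof.
move=> K1; elim: J => [|J IH]; first by rewrite leqn0 => /eqP ->; rewrite !big_geq.
rewrite leq_eqVlt ltnS => /orP[/eqP ->|h]; first by rewrite !big_geq.
rewrite big_nat_recr //= -IH // -expnSr.
by rewrite (big_cat_nat _ (n := (K ^ J).+1)) //= ltnS leq_exp2l.
Qed.

(** On the block from [K ^ j] to [K ^ j.+1], [ln n >= j * ln K] and the mass is at least [eta].
    Under the bound on [J = trunc_log K M], the sum of [j] over [A0 <= j < J] is at least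
    [J ^ 2 / 8]. *)
Lemma log_density_lower (R : realType) (P : pred nat) (K A0 M : nat) (eta : R) :
  0 < eta -> (1 < K)%N -> (0 < M)%N ->
  (4 * A0 + 3 <= trunc_log K M)%N ->
  (forall A, (A0 <= A)%N -> (A * K <= M)%N ->
    eta <= \sum_(A.+1 <= n < (A * K).+1 | P n) n%:R^-1) ->
  eta * ln K%:R * ((trunc_log K M)%:R ^+ 2 / 8) <=
  \sum_(1 <= n < M.+1 | P n) ln (n%:R : R) / n%:R.
Proof.
move=> eta0 K1 M0; set J := trunc_log K M => J4 hP.
have K0 : (0 < K)%N by apply: ltnW.
have lK : 0 < ln (K%:R : R) by rewrite ln_gt0 // ltr1n.
have jJ : (A0 <= J)%N by lia.
have KJM : (K ^ J <= M)%N by apply: trunc_logP.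
have f0 n : 0 <= ln (n%:R : R) / n%:R.
  case: n => [|n]; first by rewrite invr0 mulr0.
  by rewrite divr_ge0 // ln_ge0 // ler1n.
apply: (@le_trans _ _ (\sum_((K ^ A0).+1 <= n < (K ^ J).+1 | P n) ln (n%:R : R) / n%:R)); last first.
  by apply: ler_sum_subrange => //; rewrite ltnS leq_exp2l.
rewrite sum_geometric_blocks //.
apply: (@le_trans _ _ (\sum_(A0 <= j < J) j%:R * (eta * ln (K%:R : R)))).
  rewrite -mulr_suml mulrC ler_wpM2r ?mulr_ge0 ?(ltW eta0) ?(ltW lK) //.
  rewrite ler_pdivrMr // -natr_sum -natrX -natrM ler_nat.
  have := sum_nat_range_ge jJ; move: (\sum_(A0 <= j < J) j)%N => s.
  have h16 : (16 * (A0 * A0) <= J * J)%N.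
    by rewrite (_ : 16 * (A0 * A0) = (4 * A0) * (4 * A0))%N; [apply: leq_mul; lia | lia].
  have h3 : (3 * J <= J * J)%N by apply: leq_mul; lia.
  by rewrite expnS expn1; move: (A0 * A0)%N (J * J)%N h16 h3 => u v; lia.
apply: ler_sum_nat => j /andP[j0 jJ'].
have Kj : (K ^ j * K <= M)%N.
  by rewrite -expnSr (leq_trans _ KJM) // leq_exp2l.
have A0K : (A0 <= K ^ j)%N by rewrite (leq_trans j0) // ltnW // ltn_expl.
have h := hP _ A0K Kj.
have lKj : 0 <= j%:R * ln (K%:R : R) by rewrite mulr_ge0 // ltW.
rewrite mulrCA mulrC (le_trans (ler_wpM2l lKj h)) // mulr_sumr big_nat_cond [leRHS]big_nat_cond.
apply: ler_sum => n /andP[/andP[n1 n2] _]; rewrite ler_wpM2r //.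
rewrite mulr_natl -lnXn ?ltr0n // ler_ln ?posrE ?exprn_gt0 ?ltr0n ?(leq_ltn_trans _ n1) //.
by rewrite -natrX ler_nat ltnW.
Qed.

(** For [n <= N %/ y] the bound [beta] applies, and on the good [n] it improves to [b], a saving of
    at least [b] as [2 * b <= beta]. The remaining [n] have bounded logarithmic mass and cost
    [O(x * ln x)]. That [kap] depends on [b] alone, not on [beta], is what the contraction needs. *)
Lemma psi_err_sum_bound (R : realType) (b : R) : 0 < b -> exists2 kap : R, 0 < kap &
  forall beta Y : R, 1 <= Y -> 2 * b <= beta ->
  (forall y, Y <= y -> `|psi_err y| <= beta * y) ->
  exists D X : R, forall x, X <= x ->
  summatory (fun n => ln n%:R * `|psi_err (x / n%:R)|) x <=
  x * ((beta - kap) * (ln x ^+ 2 / 2) + D * ln x).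
Proof.
move=> b0; have [K [A0 [eta eta0 [K1 hK]]]] := small_psi_err_block b0.
have K0 : (0 < K)%N by apply: ltnW.
have lK : 0 < ln (K%:R : R) by rewrite ln_gt0 // ltr1n.
exists (b * (eta / (16 * ln K%:R))).
  by rewrite mulr_gt0 // divr_gt0 // mulr_gt0.
move=> beta Y Y1 bb hY.
pose y := (Num.truncn Y).+1.
have Yy : Y <= y%:R by apply: ltW; case/andP: (truncn_itv (le_trans ler01 Y1)).
have y0 : (0 < y)%N by [].
pose D := beta + 7 * (1 + ln (2 * y%:R)).
pose t := trunc_log K (2 * y).
(* The exponent forces [J = trunc_log K M] to be at least [4 * A0 + 3], for the density bound, and
   at least [t.+2], so that [ln x <= 2 * J * ln K]. *)
exists D, (y * K ^ (4 * A0 + 3 + t.+2))%:R => x xX.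
have pK : (0 < K ^ (4 * A0 + 3 + t.+2))%N by rewrite expn_gt0 K0.
have x1 : 1 <= x by rewrite (le_trans _ xX) // ler1n muln_gt0.
have x0 : 0 < x by lra.
have l0 : 0 <= ln x by rewrite ln_ge0.
have [N1 Nx _] := truncn_bounds x1.
rewrite /summatory; set N := Num.truncn x in N1 Nx *.
have N0 : (0 < N)%N by rewrite truncn_gt0.
pose M := (N %/ y)%N.
have KM : (K ^ (4 * A0 + 3 + t.+2) <= M)%N.
  by rewrite leq_divRL // mulnC truncn_ge_nat // ltW.
have M0 : (0 < M)%N by apply: leq_trans KM.
have MN : (M <= N)%N by rewrite leq_div.
have MyN : (M * y <= N)%N by rewrite leq_divM.
have NMy : (N < M.+1 * y)%N by rewrite ltn_ceil.
set J := trunc_log K M.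
have JJ : (4 * A0 + 3 + t.+2 <= J)%N by rewrite trunc_log_max.
have M0' : 0 < M%:R :> R by rewrite ltr0n.
have N0' : 0 < N%:R :> R by rewrite ltr0n.
have lM : ln (M%:R : R) <= ln x by rewrite ler_ln ?posrE // (le_trans _ Nx) // ler_nat.
have lM0 : 0 <= ln (M%:R : R) by rewrite ln_ge0 // ler1n.
have NM2 : (N <= M * (2 * y))%N.
  by rewrite (leq_trans (ltnW NMy)) // mulnA leq_mul2r muln2 -addnn -addn1 leq_add2l M0 orbT.
have xJ : ln x <= 2 * J%:R * ln (K%:R : R).
  have NJ : (N < K ^ (J + J))%N.
    rewrite (leq_ltn_trans NM2) //.
    rewrite (@leq_trans (K ^ J.+1 * K ^ t.+1)) //.
      by rewrite ltn_mul // trunc_log_ltn.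
    by rewrite -expnD leq_exp2l // addSnnS leq_add2l (leq_trans (leq_addl _ _) JJ).
  have : x <= (K ^ (J + J))%:R.
    have := truncnS_gt x; rewrite -/N => /ltW/le_trans; apply; by rewrite ler_nat.
  rewrite -ler_ln ?posrE ?ltr0n ?expn_gt0 ?K0 // => /le_trans; apply.
  by rewrite natrX lnXn ?ltr0n // -[leLHS]mulr_natl natrD -mulr2n -[J%:R *+ 2]mulr_natl.
pose r n := psi_err (x / n%:R).
pose P n := `|r n| <= b * (x / n%:R).
have hP A : (A0 <= A)%N -> (A * K <= M)%N ->
    eta <= \sum_(A.+1 <= n < (A * K).+1 | P n) n%:R^-1.
  by move=> A0A AK; apply: hK => //; apply: leq_trans MN.
have J4 : (4 * A0 + 3 <= J)%N by apply: leq_trans JJ; rewrite leq_addr.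
have := log_density_lower eta0 K1 M0 J4 hP; rewrite -/J.
set ES := \sum_(1 <= n < M.+1 | P n) _ => hES.
have hES' : eta / (32 * ln K%:R) * ln x ^+ 2 <= ES.
  apply: le_trans hES; have lK0 := ltW lK.
  rewrite (_ : eta * ln K%:R * (J%:R ^+ 2 / 8) =
    eta / (32 * ln K%:R) * (2 * J%:R * ln K%:R) ^+ 2); last first.
    by field; rewrite gt_eqF.
  rewrite ler_wpM2l ?divr_ge0 ?(ltW eta0) ?mulr_ge0 //.
  by rewrite ler_pXn2r ?nnegrE // mulr_ge0 // mulr_ge0.
have part1 : \sum_(1 <= n < M.+1) ln n%:R * `|r n| <=
    x * (beta * (\sum_(1 <= n < M.+1) ln n%:R / n%:R) - (beta - b) * ES).
  rewrite /ES [X in (beta - b) * X]big_mkcond !mulr_sumr -sumrB mulr_sumr.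
  apply: ler_sum_nat => n /andP[n0 nM].
  have n0' : 0 < n%:R :> R by rewrite ltr0n.
  have ln0 : 0 <= ln (n%:R : R) by rewrite ln_ge0 // ler1n.
  case: ifP => [Pn|_].
    rewrite (_ : x * _ = ln n%:R * (b * (x / n%:R))); last by ring.
    by rewrite ler_wpM2l.
  rewrite mulr0 subr0 (_ : x * _ = ln n%:R * (beta * (x / n%:R))); last by ring.
  rewrite ler_wpM2l // hY // (le_trans Yy) // ler_pdivlMr // -natrM.
  rewrite (le_trans _ Nx) // ler_nat (leq_trans _ MyN) // mulnC leq_mul2r.
  by rewrite -ltnS nM orbT.
have part2 : \sum_(M.+1 <= n < N.+1) ln n%:R * `|r n| <=
    7 * x * ln x * (1 + ln (2 * y%:R)).
  apply: (@le_trans _ _ (\sum_(M.+1 <= n < N.+1) 7 * x * ln x * n%:R^-1)).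
    apply: ler_sum_nat => n /andP[Mn nN].
    have n0 : (0 < n)%N by apply: leq_ltn_trans Mn.
    have n0' : 0 < n%:R :> R by rewrite ltr0n.
    have xn0 : 0 <= x / n%:R by rewrite divr_ge0 // ltW.
    rewrite (_ : 7 * x * ln x / n%:R = ln x * (7 * (x / n%:R))); last by ring.
    rewrite ler_pM ?psi_err_le // ?ln_ge0 ?ler1n // ler_ln ?posrE //.
    by rewrite (le_trans _ Nx) // ler_nat.
  rewrite -mulr_sumr ler_wpM2l ?mulr_ge0 ?(ltW x0) //.
  have -> : \sum_(M.+1 <= n < N.+1) n%:R^-1 = harmonic_sum R N - harmonic_sum R M.
    by rewrite /harmonic_sum (big_cat_nat _ (m := 1%N) (n := M.+1) (p := N.+1)) //= addrC addrK.
  have h1 := harmonic_sum_le R N0.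
  have h2 : ln M%:R <= harmonic_sum R M.
    by rewrite (le_trans _ (harmonic_sum_ge R _)) // ler_ln ?posrE ?ltr0n // ler_nat.
  have h3 : ln N%:R <= ln M%:R + ln (2 * y%:R) :> R.
    rewrite -lnM ?posrE ?mulr_gt0 ?ltr0n // ler_ln ?posrE ?mulr_gt0 ?ltr0n //.
    by rewrite -!natrM ler_nat.
  lra.
have h4 := sum_ln_div R M0.
have h5 : ln (M%:R : R) ^+ 2 <= ln x ^+ 2 by rewrite ler_pXn2r ?nnegrE.
rewrite (big_cat_nat _ (m := 1%N) (n := M.+1) (p := N.+1)) //=.
apply: (le_trans (lerD part1 part2)).
rewrite (_ : 7 * x * ln x * (1 + ln (2 * y%:R)) = x * (7 * ln x * (1 + ln (2 * y%:R)))); last by ring.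
rewrite -mulrDr ler_wpM2l ?(ltW x0) //.
have beta0 : 0 <= beta by lra.
have h6 : \sum_(1 <= n < M.+1) ln (n%:R : R) / n%:R <= ln x ^+ 2 / 2 + ln x by lra.
have h7 := ler_wpM2l beta0 h6.
have ES0 : 0 <= ES.
  apply: le_trans hES'; rewrite mulr_ge0 ?sqr_ge0 // divr_ge0 ?(ltW eta0) //.
  by rewrite mulr_ge0 // ltW.
have h8 : b * (eta / (32 * ln K%:R) * ln x ^+ 2) <= (beta - b) * ES.
  apply: (le_trans (ler_wpM2l (ltW b0) hES')).
  by rewrite ler_wpM2r //; lra.
rewrite (_ : (beta - b * (eta / (16 * ln K%:R))) * (ln x ^+ 2 / 2) =
   beta * (ln x ^+ 2 / 2) - b * (eta / (32 * ln K%:R) * ln x ^+ 2)); last first.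
  by field; rewrite gt_eqF.
rewrite /D; lra.
Qed.

(** Insert [psi_err_sum_bound] into [psi_err_ln2_avg] and divide by [ln x ^ 2]. Half of the gain
    absorbs the terms of order [ln x], as soon as [ln x >= T]. *)
Lemma psi_err_contraction (R : realType) (b : R) : 0 < b -> exists2 kap : R, 0 < kap &
  forall beta : R, 2 * b <= beta ->
  (exists X, forall y, X <= y -> `|psi_err y| <= beta * y) ->
  exists X, forall y, X <= y -> `|psi_err y| <= (beta - kap) * y.
Proof.
move=> b0; have [kap kap0 hk] := psi_err_sum_bound b0.
have [C C0 hC] := psi_err_ln2_avg R.
exists (kap / 2) => [|beta bb [Y hY]]; first by rewrite divr_gt0.
have hY' y : Num.max 1 Y <= y -> `|psi_err y| <= beta * y.
  by rewrite ge_max => /andP[_]; exact: hY.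
have Y1 : 1 <= Num.max 1 Y by rewrite le_max lexx.
have [D [X hX]] := hk beta _ Y1 bb hY'.
pose c := 2 * D + C * 2.
pose T := Num.max 1 (2 * (`|c| / kap)).
exists (Num.max X (expR T)) => x; rewrite ge_max => /andP[xX xT].
have T1 : 1 <= T by rewrite le_max lexx.
have Tc : 2 * (`|c| / kap) <= T by rewrite le_max lexx orbT.
have x0 : 0 < x := lt_le_trans (expR_gt0 _) xT.
have lT : T <= ln x by rewrite -ler_expR lnK.
have l1 : 1 <= ln x := le_trans T1 lT.
have x1 : 1 <= x by rewrite leNgt; apply/negP => /ltW/ln_le0; lra.
have := hC x x1; have := hX x xX.
set S := summatory _ _ => hS h.
have l2 : 0 < ln x ^+ 2 by rewrite exprn_gt0 //; lra.
rewrite -(ler_pM2r l2); apply: (le_trans h).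
have e1 : C * (x * (1 + ln x)) <= C * (x * (2 * ln x)).
  by rewrite ler_wpM2l // ler_wpM2l ?(ltW x0) //; lra.
have e2 : `|c| <= kap / 2 * ln x.
  have := le_trans Tc lT; rewrite mulrA ler_pdivrMr //; lra.
have e3 : c * ln x <= kap / 2 * ln x ^+ 2.
  rewrite expr2 mulrA ler_wpM2r ?(le_trans (ler_norm _) e2) //; lra.
have e4 := ler_wpM2l (ltW x0) e3.
apply: (@le_trans _ _ (x * ((beta - kap) * ln x ^+ 2 + c * ln x))).
  by rewrite /c; lra.
lra.
Qed.

(** If the infimum of the admissible [beta] were positive, contraction with [b] equal to half of it,
    applied to an admissible [beta] within [kap] of it, would give an admissible value below it. *)
Lemma psi_err_little_o (R : realType) (e : R) : 0 < e ->
  exists X, forall x, X <= x -> `|psi_err x| <= e * x.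
Proof.
move=> e0.
pose B : set R := [set beta | 0 <= beta /\ exists X, forall x, X <= x -> `|psi_err x| <= beta * x].
have hi : has_inf B.
  split; last by exists 0 => y [].
  by exists 7; split => //; exists 0; exact: psi_err_le.
have i0 : 0 <= inf B by apply: lb_le_inf; [case: hi | move=> y []].
case: (leP (inf B) 0) => [infle|infgt].
  have infe : 0 < e - inf B by lra.
  have [beta [_ [X hX]] be] := inf_adherent infe hi.
  exists (Num.max 0 X) => x; rewrite ge_max => /andP[x0 xX].
  by apply: (le_trans (hX _ xX)); rewrite ler_wpM2r //; lra.
have b0 : 0 < inf B / 2 by rewrite divr_gt0.
have [kap kap0 hk] := psi_err_contraction b0.
have [beta Bb bk] := inf_adherent kap0 hi.
have bi : inf B <= beta by apply: ge_inf => //; case: hi.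
have [_ hb] := Bb.
have bb : 2 * (inf B / 2) <= beta by lra.
have [X hX] := hk beta bb hb.
suff : B (beta - kap) by move=> /(ge_inf (proj2 hi)); lra.
split; last by exists X.
(* A negative factor would bound an absolute value by a negative number at a point that is at least
   1. *)
rewrite leNgt; apply/negP => neg.
have X1 : X <= Num.max 1 X by rewrite le_max lexx orbT.
have := hX _ X1; have : 1 <= Num.max 1 X by rewrite le_max lexx.
have := normr_ge0 (psi_err (Num.max 1 X)); move: (Num.max 1 X) => z; nra.
Qed.

Lemma near_pinftyP (R : realType) (P : R -> Prop) :
  (\forall x \near +oo, P x) <-> exists X, forall x, X <= x -> P x.
Proof.
split=> [[M [_ hM]]|[X hX]].
  by exists (M + 1) => x Mx; apply: hM; lra.
by exists X; split; [exact: num_real | move=> x /ltW; exact: hX].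
Qed.

Lemma cvg_pinfty_distP (R : realType) (f : R -> R) (l : R) :
  f x @[x --> +oo] --> l <->
  forall e, 0 < e -> exists X, forall x, X <= x -> `|f x - l| <= e.
Proof.
split=> [/cvgrPdistC_le h e e0|h]; first by apply/near_pinftyP/h.
by apply/cvgrPdistC_le => e e0; apply/near_pinftyP/h.
Qed.

Lemma cvg_ln_div_sqrt (R : realType) : ln x / Num.sqrt x @[x --> +oo] --> (0 : R).
Proof.
apply/cvg_pinfty_distP => e e0; exists (expR (Num.max 1 (16 / e))) => x hx.
have x0 : 0 < x := lt_le_trans (expR_gt0 _) hx.
have : Num.max 1 (16 / e) <= ln x by rewrite -ler_expR lnK.
rewrite ge_max => /andP[l1 le].
have x1 : 1 <= x by rewrite leNgt; apply/negP => /ltW/ln_le0; lra.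
have s0 : 0 < Num.sqrt x by rewrite sqrtr_gt0.
have := sqr_ln_le_sqrt x1; rewrite subr0 ger0_norm; last first.
  by rewrite divr_ge0 ?(ltW s0) //; lra.
move=> h; rewrite ler_pdivrMr //.
rewrite ler_pdivrMr // in le; move: (Num.sqrt x) h s0 => s h s0.
have : e * (1 + ln x) ^+ 2 <= e * (16 * s) by rewrite ler_wpM2l // ltW.
have : ln x * 16 <= e * (1 + ln x) ^+ 2.
  have : ln x * 16 <= ln x * (ln x * e) by rewrite ler_wpM2l //; lra.
  nra.
by lra.
Qed.

Definition prime_sum (R : realType) (g : nat -> R) (x : R) : R :=
  \sum_(1 <= p < (Num.truncn x).+1 | prime p) g p.

Lemma summatory_mangoldt_of (R : realType) (g : nat -> R) (x : R) :
  summatory (mangoldt_of g) x =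
  \sum_(1 <= p < (Num.truncn x).+1 | prime p)
    (\sum_(1 <= k < (Num.truncn x).+1) (p ^ k <= Num.truncn x)%N%:R) * g p.
Proof.
rewrite /summatory; set N := Num.truncn x.
transitivity (\sum_(1 <= n < N.+1) \sum_(1 <= p < N.+1 | prime p)
    \sum_(1 <= k < N.+1) (n == p ^ k)%N%:R * g p).
  by apply: eq_big_nat => n /andP[n0 nN]; rewrite (@mangoldt_of_widen _ _ n N).
rewrite (exchange_big_dep_nat prime) //=; apply: eq_bigr => p pp.
rewrite (exchange_big_dep_nat predT) //= mulr_suml; apply: eq_bigr => k _.
rewrite -mulr_suml pp; congr (_ * _).
case: (leqP (p ^ k) N) => h.
  have pk0 : (0 < p ^ k)%N by rewrite expn_gt0 prime_gt0.
  have kin : (p ^ k)%N \in index_iota 1 N.+1 by rewrite mem_index_iota pk0.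
  rewrite (bigD1_seq _ kin (iota_uniq _ _)) /= eqxx big1 ?addr0 //.
  by move=> n /negbTE ->.
rewrite big_nat_cond big1 // => n /andP[/andP[_ nN] _].
by rewrite ltn_eqF // (leq_ltn_trans _ h).
Qed.

(** A power [p ^ k <= x] with [k >= 2] has [p <= sqrt x], and the exponents are at most
    [log_2 x <= 2 * ln x], using [ln 2 >= 1 / 2]. *)
Lemma prime_sum_bounds (R : realType) (g : nat -> R) (x : R) : 1 <= x ->
  (forall p, prime p -> 0 <= g p) ->
  0 <= summatory (mangoldt_of g) x - prime_sum g x <=
  2 * ln x * summatory (mangoldt_of g) (Num.sqrt x).
Proof.
move=> x1 g0; have x0 : 0 < x by lra.
have [_ Nx xN] := truncn_bounds x1.
have cnt1 p : prime p -> (p <= Num.truncn x)%N ->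
    1 <= \sum_(1 <= k < (Num.truncn x).+1) (p ^ k <= Num.truncn x)%N%:R :> R.
  move=> pp pN; rewrite big_ltn ?ltnS ?truncn_gt0 // expn1 pN lerDl.
  by apply: sumr_ge0 => i _; rewrite ler0n.
have low y : prime_sum g y <= summatory (mangoldt_of g) y.
  rewrite summatory_mangoldt_of /prime_sum big_nat_cond [leRHS]big_nat_cond.
  apply: ler_sum => p /andP[/andP[p0 pN] pp]; rewrite ler_peMl ?g0 //.
  have Ny : (0 < Num.truncn y)%N by rewrite (leq_trans p0).
  rewrite big_ltn ?ltnS // expn1 -ltnS pN lerDl.
  by apply: sumr_ge0 => i _; rewrite ler0n.
rewrite subr_ge0 low /=.
set Q := Num.truncn (Num.sqrt x); set N := Num.truncn x in Nx xN cnt1.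
set t := trunc_log 2 N.
have N0 : (0 < N)%N by rewrite truncn_gt0.
have tx : t%:R <= 2 * ln x.
  have : (2 ^ t)%:R <= x by rewrite (le_trans _ Nx) // ler_nat trunc_logP.
  rewrite -ler_ln ?posrE ?ltr0n ?expn_gt0 // natrX lnXn ?ltr0n // -[leLHS]mulr_natl => h.
  have := @lnB_ge R 1 2 ltr01 (ltr0n _ 2); rewrite ln1 subr0 => h2.
  have : t%:R * 2^-1 <= t%:R * ln 2 :> R by rewrite ler_wpM2l //; lra.
  lra.
have sx : Num.sqrt x <= x.
  rewrite -[leRHS]sqr_sqrtr ?(ltW x0) // expr2 ler_peMl ?sqrtr_ge0 //.
  by rewrite -[leLHS]sqrtr1 ler_wsqrtr.
have QN : (Q <= N)%N by rewrite le_truncn.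
apply: (@le_trans _ _ (t%:R * prime_sum g (Num.sqrt x))); last first.
  rewrite ler_pM ?low // /prime_sum ?sumr_ge0 //; exact: g0.
rewrite lerBlDl summatory_mangoldt_of /prime_sum -/N -/Q.
have QE p : (Q < p)%N -> (N < p * p)%N.
  move=> Qp; rewrite truncn_lt_nat ?(ltW x0) // natrM.
  have h : Num.sqrt x < p%:R by rewrite -truncn_lt_nat ?sqrtr_ge0.
  rewrite -[ltLHS]sqr_sqrtr ?(ltW x0) // expr2.
  by rewrite ltr_pM ?sqrtr_ge0.
apply: (@le_trans _ _ (\sum_(1 <= p < N.+1 | prime p) (1 + (p <= Q)%N%:R * t%:R) * g p)).
  rewrite big_nat_cond [leRHS]big_nat_cond.
  apply: ler_sum => p /andP[/andP[p0 pN] pp]; rewrite ler_wpM2r ?g0 //.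
  rewrite big_ltn // expn1 -ltnS pN lerD2l.
  apply: (@le_trans _ _ (\sum_(2 <= k < N.+1) (p <= Q)%N%:R * (k <= t)%N%:R)).
    apply: ler_sum_nat => k /andP[k2 kN]; rewrite -natrM mulnb ler_nat.
    case pk: (p ^ k <= N)%N => //.
    have k0 : (0 < k)%N by apply: ltnW.
    have -> : (k <= t)%N.
      by apply: trunc_log_max => //; rewrite (leq_trans _ pk) // leq_exp2r // prime_gt1.
    suff -> : (p <= Q)%N by [].
    case: (leqP p Q) => // /QE; rewrite ltnNge; suff -> : (p * p <= N)%N by [].
    by rewrite (leq_trans _ pk) // -[(p * p)%N]/(p ^ 2)%N leq_exp2l ?(prime_gt1 pp).
  rewrite -mulr_sumr ler_wpM2l //.
  apply: (@le_trans _ _ (\sum_(1 <= k < N.+1) (k <= t)%N%:R)).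
    by apply: ler_sum_subrange.
  by rewrite sum_nat_leq ler_nat geq_minl.
rewrite (eq_bigr (fun p => g p + t%:R * ((p <= Q)%N%:R * g p))) => [|p _]; last by ring.
rewrite big_split /= lerD2l -mulr_sumr ler_wpM2l //.
rewrite (big_cat_nat _ (m := 1%N) (n := Q.+1) (p := N.+1)) //=.
rewrite [X in _ + X]big_nat_cond [X in _ + X]big1 => [|p /andP[/andP[Qp _] _]]; last first.
  by rewrite leqNgt Qp mul0r.
rewrite addr0; apply: ler_sum => p pp.
by case: (p <= Q)%N; rewrite ?mul1r // mul0r g0.
Qed.

Definition theta (R : realType) : R -> R := prime_sum (fun p => ln p%:R).

Lemma prime_number_theorem (R : realType) : theta x / x @[x --> +oo] --> (1 : R).
Proof.
apply/cvg_pinfty_distP => e e0.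
have e2 : 0 < e / 2 by lra.
(* Proper prime powers contribute at most [2 * ln x * 6 * sqrt x], so this share makes them at most
   [e / 2 * x]. *)
have e3 : 0 < e / 24 by lra.
have [X hX] := psi_err_little_o e2.
have /cvg_pinfty_distP/(_ _ e3)[Y hY] := @cvg_ln_div_sqrt R.
exists (Num.max 1 (Num.max X Y)) => x; rewrite !ge_max => /and3P[x1 xX xY].
have x0 : 0 < x by lra.
have g0 p : prime p -> 0 <= ln (p%:R : R) by move=> pp; rewrite ln_ge0 // ler1n prime_gt0.
have /andP[h1 h2] := prime_sum_bounds x1 g0.
have s0 : 0 < Num.sqrt x by rewrite sqrtr_gt0.
have h3 := psi_le (ltW s0).
have l0 : 0 <= ln x by rewrite ln_ge0.
have h4 : ln x * Num.sqrt x <= e / 24 * x.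
  have := hY _ xY; rewrite subr0 => /(le_trans (ler_norm _)); rewrite ler_pdivrMr // => h4.
  have := ler_wpM2r (ltW s0) h4; by rewrite -[leRHS]mulrA -expr2 sqr_sqrtr // ltW.
have h5 : 2 * ln x * psi (Num.sqrt x) <= e / 2 * x.
  rewrite (le_trans (ler_wpM2l _ h3)) ?mulr_ge0 //; lra.
have -> : theta x / x - 1 = (theta x - x) / x by rewrite mulrBl divff // gt_eqF.
rewrite normrM normfV (gtr0_norm x0) ler_pdivrMr //.
have := hX _ xX; rewrite /psi_err !ler_norml => /andP[k1 k2].
move: h1 h2; rewrite -/(mangoldt R) -/(psi x) -/(psi (Num.sqrt x)) -/(theta x) => h1 h2.
by apply/andP; split; lra.
Qed.

(** * Dominated convergence and regular variation *)

Lemma cvg_pinfty_scale (R : realType) (f : R -> R) (c l : R) : 0 < c ->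
  f x @[x --> +oo] --> l -> f (c * x) @[x --> +oo] --> l.
Proof.
move=> c0 /cvg_pinfty_distP h; apply/cvg_pinfty_distP => e /h[X hX].
by exists (X / c) => x; rewrite ler_pdivrMr // mulrC; exact: hX.
Qed.

Lemma cvg_pinfty_eq (R : realType) (f g : R -> R) (l : R) :
  (exists X, forall x, X <= x -> f x = g x) ->
  f x @[x --> +oo] --> l -> g x @[x --> +oo] --> l.
Proof.
move=> [Y hY] /cvg_pinfty_distP h; apply/cvg_pinfty_distP => e /h[X hX].
exists (Num.max X Y) => x; rewrite ge_max => /andP[xX xY].
by rewrite -hY // hX.
Qed.

Lemma powR_expR (R : realType) (x a : R) : 0 < x -> x `^ a = expR (a * ln x).
Proof. by move=> x0; rewrite /powR gt_eqF. Qed.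

Lemma powR_inv_base (R : realType) (x a : R) : 0 < x -> (x^-1) `^ a = x `^ (- a).
Proof. by move=> x0; rewrite !powR_expR ?invr_gt0 // lnV ?posrE // mulrN mulNr. Qed.

(** Each term is at most a difference of consecutive values of [u ^ (1 - a) / (a - 1)], by
    [exp t >= 1 + t], and the bound telescopes. *)
Lemma sum_powR_tail (R : realType) (a : R) M N : 1 < a -> (0 < M)%N ->
  \sum_(M.+1 <= m < N.+1) m%:R `^ (- a) <= M%:R `^ (1 - a) / (a - 1).
Proof.
move=> a1 M0; have b0 : 0 < a - 1 by lra.
have step m : (0 < m)%N ->
    m.+1%:R `^ (- a) <= (m%:R `^ (1 - a) - m.+1%:R `^ (1 - a)) / (a - 1).
  move=> m0; set u : R := m%:R; have -> : m.+1%:R = u + 1 :> R by rewrite natr1.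
  have u0 : 0 < u by rewrite ltr0n.
  have v0 : 0 < u + 1 by lra.
  have := lnB_ge u0 v0; rewrite addrAC subrr add0r div1r => h.
  have -> : u `^ (1 - a) = (u + 1) `^ (1 - a) * expR ((a - 1) * (ln (u + 1) - ln u)).
    by rewrite !powR_expR // -expRD; congr expR; ring.
  have -> : (u + 1) `^ (- a) = (u + 1) `^ (1 - a) * (u + 1)^-1.
    rewrite -[X in _ * X]powR_inv1 ?(ltW v0) // -powRD ?(gt_eqF v0) ?implybT //.
    by congr (_ `^ _); ring.
  rewrite ler_pdivlMr //; have P0 := powR_gt0 (1 - a) v0.
  have h2 : (a - 1) * (u + 1)^-1 <= (a - 1) * (ln (u + 1) - ln u) by rewrite ler_pM2l.
  have := expR_ge1Dx ((a - 1) * (ln (u + 1) - ln u)).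
  move: (expR _) (_ `^ _) P0 h2 => E P P0 h2 h3.
  have := ler_wpM2l (ltW P0) (le_trans (lerD (lexx 1) h2) h3).
  by move: (_^-1) => i; lra.
case: (leqP M N) => [MN|NM]; last first.
  by rewrite (big_geq (leqW NM)) divr_ge0 ?powR_ge0 // ltW.
apply: (@le_trans _ _ ((M%:R `^ (1 - a) - N%:R `^ (1 - a)) / (a - 1))); last first.
  by rewrite ler_pM2r ?invr_gt0 // gerBl powR_ge0.
elim: N MN => [|N IH]; first by rewrite leqn0 => /eqP ME; rewrite ME in M0.
rewrite leq_eqVlt ltnS => /orP[/eqP <-|MN]; first by rewrite big_geq // subrr mul0r.
rewrite big_nat_recr //=.
by apply: (le_trans (lerD (IH MN) (step N (leq_trans M0 MN)))); rewrite -mulrDl addrA subrK.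
Qed.

Lemma powR_neg_small (R : realType) (b e : R) : 0 < b -> 0 < e ->
  exists M0 : nat, forall M, (M0 <= M)%N -> M%:R `^ (- b) <= e.
Proof.
move=> b0 e0; exists (Num.truncn (expR (1 / (b * e)))).+1 => M hM.
have h : expR (1 / (b * e)) <= M%:R.
  rewrite (le_trans (ltW (truncnS_gt _))) // ler_nat; exact: hM.
have M0 : 0 < M%:R :> R by apply: lt_le_trans h; exact: expR_gt0.
have l0 : 1 / (b * e) <= ln M%:R by rewrite -ler_expR lnK.
rewrite powR_expR // mulNr expRN invf_ple ?posrE ?expR_gt0 //.
apply: le_trans (expR_ge1Dx _).
rewrite ler_pdivrMr ?mulr_gt0 // in l0; rewrite -div1r ler_pdivrMr //; nra.
Qed.

Lemma cvg_sum_nat (R : realType) (T : R -> nat -> R) (t : nat -> R) M :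
  (forall m, (0 < m)%N -> T x m @[x --> +oo] --> t m) ->
  \sum_(1 <= m < M.+1) T x m @[x --> +oo] --> \sum_(1 <= m < M.+1) t m.
Proof.
move=> h; elim: M => [|M IH].
  by rewrite big_geq //; under eq_fun do rewrite big_geq //; exact: cvg_cst.
rewrite big_nat_recr //=; under eq_fun do rewrite big_nat_recr //=.
by apply: cvgD => //; exact: h.
Qed.

(** Dominated convergence for sums whose length grows with [x]: since [a > 1], the tail beyond a
    fixed [M] is small uniformly in [x], and the finite head converges termwise. *)
Lemma tannery (R : realType) (T : R -> nat -> R) (t : nat -> R) (K a l X0 : R) :
  1 < a -> 0 <= K ->
  (forall x m, X0 <= x -> (0 < m <= Num.truncn x)%N -> `|T x m| <= K * m%:R `^ (- a)) ->
  (forall m, (0 < m)%N -> T x m @[x --> +oo] --> t m) ->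
  \sum_(1 <= m < M.+1) t m @[M --> \oo] --> l ->
  summatory (T x) x @[x --> +oo] --> l.
Proof.
move=> a1 K0 hT ht /cvgrPdistC_le hl; apply/cvg_pinfty_distP => e e0.
have b0 : 0 < a - 1 by lra.
have e3 : 0 < e / 3 by lra.
have e' : 0 < e / 3 * (a - 1) / (K + 1) by rewrite divr_gt0 ?mulr_gt0 //; lra.
have [M1 _ hM1] := hl _ e3.
have [M2 hM2] := powR_neg_small b0 e'.
pose M := (maxn M1 M2).+1.
have hM1' := hM1 M (leq_trans (leq_maxl _ _) (leqnSn _)).
have hM2' := hM2 M (leq_trans (leq_maxr _ _) (leqnSn _)).
have /cvg_pinfty_distP/(_ _ e3)[X hX] := @cvg_sum_nat R T t M ht.
exists (Num.max (Num.max X0 X) M%:R) => x; rewrite !ge_max => /andP[/andP[xX0 xX] xM].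
have MN : (M <= Num.truncn x)%N by rewrite truncn_ge_nat // (le_trans _ xM).
have tail : `|\sum_(M.+1 <= m < (Num.truncn x).+1) T x m| <= e / 3.
  apply: (le_trans (ler_norm_sum _ _ _)).
  apply: (@le_trans _ _ (\sum_(M.+1 <= m < (Num.truncn x).+1) K * m%:R `^ (- a))).
    apply: ler_sum_nat => m /andP[Mm mN]; apply: hT => //.
    by rewrite (leq_ltn_trans _ Mm).
  rewrite -mulr_sumr (le_trans (ler_wpM2l K0 (@sum_powR_tail R a M _ a1 isT))) //.
  rewrite (_ : 1 - a = - (a - 1)); last by ring.
  rewrite mulrA ler_pdivrMr // (le_trans (ler_wpM2l K0 hM2')) //.
  have := mulr_gt0 e3 b0; move: (e / 3 * (a - 1)) => c c0.
  by rewrite mulrA ler_pdivrMr; lra.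
have := hX x xX; rewrite /summatory.
rewrite (big_cat_nat _ (m := 1%N) (n := M.+1) (p := (Num.truncn x).+1)) //=.
move: hM1' tail; rewrite /=.
set u := \sum_(M.+1 <= m < _) _; set v := \sum_(1 <= m < M.+1) t m.
set w := \sum_(1 <= m < M.+1) _; rewrite !ler_norml.
by move=> /andP[? ?] /andP[? ?] /andP[? ?]; apply/andP; split; lra.
Qed.

Lemma sum_powR_le (R : realType) (s : R) N : 1 < s ->
  \sum_(1 <= m < N.+1) m%:R `^ (- s) <= 1 + (s - 1)^-1.
Proof.
move=> s1; case: N => [|N]; first by rewrite big_geq // addr_ge0 // invr_ge0; lra.
rewrite big_ltn // powR1 lerD2l.
by have := @sum_powR_tail R s 1 N.+1 s1 isT; rewrite powR1 div1r.
Qed.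

Lemma series_shift1 (R : realType) (t : nat -> R) :
  (fun M => \sum_(1 <= m < M.+1) t m) = series (fun n => t n.+1).
Proof. by apply/funext => M; rewrite /series /= big_add1. Qed.

Lemma is_cvg_powR_series (R : realType) (s : R) : 1 < s ->
  cvgn (series (fun n => n.+1%:R `^ (- s) : R)).
Proof.
move=> s1; rewrite -(series_shift1 (fun m => m%:R `^ (- s))).
apply: nondecreasing_is_cvgn.
  by move=> m n mn; apply: ler_sum_subrange.
by exists (1 + (s - 1)^-1) => _ [n _ <-]; exact: sum_powR_le.
Qed.

Lemma cvg_zeta (R : realType) (s : R) : 1 < s ->
  \sum_(1 <= m < M.+1) m%:R `^ (- s) @[M --> \oo] --> zeta s.
Proof.
move=> s1; rewrite (series_shift1 (fun m => m%:R `^ (- s))).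
exact: is_cvg_powR_series.
Qed.

Lemma zeta_gt0 (R : realType) (s : R) : 1 < s -> 0 < zeta s.
Proof.
move=> s1; apply: (@lt_le_trans _ _ 1) => //.
apply: (cvgr_to_ge (cvg_zeta s1)); exists 1%N => // M /= M1.
rewrite big_ltn ?ltnS // powR1 lerDl; apply: sumr_ge0 => i _; exact: powR_ge0.
Qed.

Lemma cvg_mobius_series (R : realType) (s : R) : 1 < s -> exists D : R,
  \sum_(1 <= m < M.+1) mobius R m * m%:R `^ (- s) @[M --> \oo] --> D.
Proof.
move=> s1; rewrite (series_shift1 (fun m => mobius R m * m%:R `^ (- s))).
exists (limn (series (fun n => mobius R n.+1 * n.+1%:R `^ (- s)))).
apply: normed_cvg.
apply: (series_le_cvg _ _ _ (is_cvg_powR_series s1)) => n //=; rewrite ?powR_ge0 //.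
by rewrite normrM (ger0_norm (powR_ge0 _ _)) ler_piMl ?powR_ge0 ?ler_norm_mobius.
Qed.

(* Doubling: [F] eventually grows at least by the factor [2 ^ a] over each dyadic step. *)
Lemma potter_bound (R : realType) (F : R -> R) (s a : R) : 0 < a -> a < s ->
  {homo F : x y / x <= y} -> (forall x, 0 <= F x) ->
  (exists X, forall x, X <= x -> 0 < F x) ->
  F (2 * x) / F x @[x --> +oo] --> 2 `^ s ->
  exists K X0 : R, [/\ 0 <= K, 1 <= X0 & forall x y, X0 <= x -> 1 <= y -> y <= x ->
    F y <= K * (y / x) `^ a * F x].
Proof.
move=> a0 as_ Fmono F0 [X1 hX1] /cvg_pinfty_distP hlim.
have gap : 0 < 2 `^ s - 2 `^ a :> R.
  by rewrite subr_gt0 !powR_expR // ltr_expR ltr_pM2r // ln_gt0 // ltr1n.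
have [X2 hX2] := hlim _ gap.
pose X0 := Num.max 1 (Num.max X1 X2).
have dbl x : X0 <= x -> 2 `^ a * F x <= F (2 * x).
  rewrite !ge_max => /and3P[_ /hX1 Fx /hX2]; rewrite ler_norml => /andP[h _].
  by rewrite -ler_pdivlMr //; lra.
have X01 : 1 <= X0 by rewrite le_max lexx.
have iter k x : X0 <= x -> (2 `^ a) ^+ k * F x <= F (2 ^+ k * x).
  move=> hx; elim: k => [|k IH]; first by rewrite !expr0 !mul1r.
  rewrite !exprS -!mulrA; apply: le_trans (dbl _ _); last first.
    by rewrite (le_trans hx) // ler_peMl ?exprn_ege1 ?ler1n //; lra.
  by rewrite ler_wpM2l ?powR_ge0.
have main x y : X0 <= y -> y <= x -> F y <= 2 `^ a * (y / x) `^ a * F x.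
  move=> Xy yx; have y0 : 0 < y by lra.
  have x0 : 0 < x by lra.
  have q1 : 1 <= x / y by rewrite ler_pdivlMr // mul1r.
  have [N1 Nx xN] := truncn_bounds q1; set N := Num.truncn (x / y) in N1 Nx xN.
  have N0 : (0 < N)%N by rewrite truncn_gt0.
  have k1 := trunc_logP (isT : 1 < 2)%N N0; have k2 := @trunc_log_ltn 2 N isT.
  set k := trunc_log 2 N in k1 k2.
  have e1 : 2 ^+ k * y <= x.
    by rewrite -ler_pdivlMr // (le_trans _ Nx) // -natrX ler_nat.
  have h1 := le_trans (iter k y Xy) (Fmono _ _ e1).
  have h2 : (x / y) `^ a <= 2 `^ a * (2 `^ a) ^+ k.
    rewrite -exprS -powR_mulrn ?powR_ge0 // -powRrM [a * _]mulrC powRrM.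
    rewrite ge0_ler_powR ?nnegrE ?(ltW a0) ?powR_ge0 //; first by lra.
    by rewrite powR_mulrn // (le_trans (ltW xN)) // natr1 -natrX ler_nat.
  have inv : (y / x) `^ a * (x / y) `^ a = 1.
    rewrite -powRM ?divr_ge0 ?(ltW x0) ?(ltW y0) // mulf_div [y * x]mulrC divff ?powR1 //.
    by rewrite mulf_neq0 ?gt_eqF.
  have -> : F y = (y / x) `^ a * (x / y) `^ a * F y by rewrite inv mul1r.
  rewrite [2 `^ a * _]mulrC -!mulrA ler_wpM2l ?powR_ge0 //.
  apply: (le_trans (ler_wpM2r (F0 y) h2)).
  by rewrite -mulrA ler_wpM2l ?powR_ge0.
(* The factor [X0 ^ a] covers [1 <= y < X0]: there [F y <= F X0], and [X0 <= X0 * y]. *)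
exists (2 `^ a * X0 `^ a), X0; split=> //; first by rewrite mulr_ge0 ?powR_ge0.
move=> x y xX y1 yx; have x0 : 0 < x by lra.
case: (leP X0 y) => [Xy|/ltW yX].
  apply: (le_trans (main x y Xy yx)); rewrite ler_wpM2r // ler_wpM2r ?powR_ge0 //.
  have e1 : (1 : R) `^ a = 1 by rewrite powR1.
  rewrite ler_peMr ?powR_ge0 // -[leLHS]e1 ge0_ler_powR ?nnegrE ?(ltW a0) //; lra.
apply: (le_trans (Fmono _ _ yX)); apply: (le_trans (main x X0 (lexx _) xX)).
have X00 : 0 <= X0 by lra.
have y0 : 0 <= y by lra.
have yx0 : 0 <= y / x by rewrite divr_ge0 // ltW.
rewrite ler_wpM2r // -mulrA ler_wpM2l ?powR_ge0 // -(powRM _ X00 yx0).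
rewrite ge0_ler_powR ?nnegrE ?(ltW a0) ?mulr_ge0 ?invr_ge0 ?(ltW x0) //.
by rewrite mulrA ler_pM2r ?invr_gt0 // ler_peMr.
Qed.

(** Two uses of [tannery]. Moebius inversion gives a limit [D], the sum of [mobius m * m ^ (- s)];
    feeding it back into the formula for [F] gives [1 = D * zeta s]. The Moebius series thus never
    has to be evaluated directly. *)
Lemma mobius_asymptotic (R : realType) (F A : R -> R) (s : R) : 1 < s ->
  {homo F : x y / x <= y} -> (forall x, 0 <= A x <= F x) ->
  (exists X, forall x, X <= x -> 0 < F x) ->
  (forall c, 0 < c -> F (c * x) / F x @[x --> +oo] --> c `^ s) ->
  (forall x, 1 <= x -> F x = summatory (fun m => A (x / m%:R)) x) ->
  A x / F x @[x --> +oo] --> (zeta s)^-1.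
Proof.
move=> s1 Fmono AF Fpos Fvar FA.
have F0 x : 0 <= F x by case/andP: (AF x) => /le_trans; apply.
(* The exponent must exceed 1 for a summable majorant and stay below [s] for the Potter bound. *)
pose a := (1 + s) / 2.
have a1 : 1 < a by rewrite /a; lra.
have as_ : a < s by rewrite /a; lra.
have a0 : 0 < a by lra.
have [K [X0 [K0 X01 hK]]] := potter_bound a0 as_ Fmono F0 Fpos (Fvar 2 (ltr0n _ 2)).
have [Y hY] := Fpos.
pose Z := Num.max X0 Y.
have hKm x m : Z <= x -> (0 < m <= Num.truncn x)%N ->
    0 <= F (x / m%:R) / F x <= K * m%:R `^ (- a).
  rewrite ge_max => /andP[xX /hY Fx] /andP[m0 mx].
  have x0 : 0 < x by lra.
  have m0' : 0 < m%:R :> R by rewrite ltr0n.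
  rewrite divr_ge0 // ler_pdivrMr //=; have mx' : m%:R <= x by rewrite -truncn_ge_nat ?ltW.
  have := hK x (x / m%:R) xX; rewrite ler_pdivlMr // mul1r mx' ler_pdivrMr //.
  rewrite ler_peMr ?ler1n ?(ltW x0) // => /(_ isT isT).
  have -> : x / m%:R / x = m%:R^-1 by rewrite mulrAC divff ?mul1r // gt_eqF.
  by rewrite powR_inv_base.
have Fm m : (0 < m)%N -> F (x / m%:R) / F x @[x --> +oo] --> m%:R `^ (- s).
  move=> m0; have m0' : 0 < (m%:R : R)^-1 by rewrite invr_gt0 ltr0n.
  have := Fvar _ m0'; rewrite powR_inv_base ?ltr0n // => h.
  by apply: cvg_pinfty_eq h; exists 0 => x _; rewrite [m%:R^-1 * x]mulrC.
have [D hD] := cvg_mobius_series s1.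
have AD : A x / F x @[x --> +oo] --> D.
  have h : summatory (fun m => mobius R m * (F (x / m%:R) / F x)) x @[x --> +oo] --> D.
    apply: (@tannery R (fun x m => mobius R m * (F (x / m%:R) / F x)) _ K a D Z a1 K0 _ _ hD).
      move=> x m xZ /(hKm x m xZ)/andP[h0 h1].
      rewrite normrM (ger0_norm h0) -[leRHS]mul1r ler_pM ?ler_norm_mobius //.
    move=> m m0; apply: cvgMl_tmp; exact: Fm.
  apply: cvg_pinfty_eq h; exists 1 => x x1; have x0 : 0 <= x by lra.
  have N0 : (0 < Num.truncn x)%N by rewrite truncn_gt0.
  have := mobius_inversion (fun k => A (x / k%:R)) N0; rewrite divr1 => <-.
  rewrite /summatory mulr_suml; apply: eq_big_nat => n /andP[n0 nN].
  rewrite mulrA FA; last by rewrite ler_pdivlMr ?ltr0n // mul1r -truncn_ge_nat.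
  rewrite summatory_div //; congr (_ * _ / _).
  by apply: eq_bigr => m _; rewrite natrM invfM mulrA.
suff E : 1 = D * zeta s.
  suff -> : (zeta s)^-1 = D by [].
  have z0 := zeta_gt0 s1; apply: (mulIf (lt0r_neq0 z0)).
  by rewrite mulVf ?gt_eqF.
have hDz : \sum_(1 <= m < M.+1) D * m%:R `^ (- s) @[M --> \oo] --> D * zeta s.
  under eq_fun do rewrite -mulr_sumr.
  apply: cvgMl_tmp; exact: cvg_zeta.
have h1 : summatory (fun m => A (x / m%:R) / F x) x @[x --> +oo] --> D * zeta s.
  apply: (@tannery R (fun x m => A (x / m%:R) / F x) _ K a _ Z a1 K0 _ _ hDz).
    move=> x m xZ mN; have /andP[h0 h1] := hKm x m xZ mN.
    have /andP[A0 AF'] := AF (x / m%:R).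
    rewrite ger0_norm; last by rewrite divr_ge0.
    by apply: le_trans h1; rewrite ler_wpM2r // invr_ge0.
  move=> m m0; have m0' : 0 < (m%:R : R)^-1 by rewrite invr_gt0 ltr0n.
  have h := cvgM (cvg_pinfty_scale m0' AD) (Fm m m0).
  apply: (cvg_pinfty_eq _ (h _)); exists (m%:R * Y) => x hx.
  have Fx : 0 < F (x / m%:R) by apply: hY; rewrite ler_pdivlMr ?ltr0n // mulrC.
  by rewrite /= [m%:R^-1 * x]mulrC mulrA divfK ?gt_eqF.
have h2 : summatory (fun m => A (x / m%:R) / F x) x @[x --> +oo] --> (1 : R).
  apply: (@cvg_pinfty_eq R (fun=> 1)); last exact: cvg_cst.
  exists (Num.max 1 Y) => x; rewrite ge_max => /andP[x1 /hY Fx].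
  by rewrite /summatory -mulr_suml -/(summatory _ _) -FA // divff // gt_eqF.
exact: (cvg_unique (@norm_hausdorff _ R) h2 h1).
Qed.

(** * From the prime sum to the function *)

Lemma cvg_ln_scale (R : realType) (c : R) : 0 < c ->
  ln (c * x) / ln x @[x --> +oo] --> (1 : R).
Proof.
move=> c0; apply/cvg_pinfty_distP => e e0; exists (expR (1 + `|ln c| / e)) => x hx.
have x0 : 0 < x := lt_le_trans (expR_gt0 _) hx.
have : 1 + `|ln c| / e <= ln x by rewrite -ler_expR lnK.
have q0 : 0 <= `|ln c| / e by rewrite divr_ge0 // ltW.
move=> h; have l0 : 0 < ln x by lra.
rewrite lnM ?posrE // mulrDl divff ?gt_eqF // addrK normrM normfV (gtr0_norm l0).
have : `|ln c| / e <= ln x by lra.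
by rewrite ler_pdivrMr // mulrC -ler_pdivrMr // mulrC mulrA => ?; rewrite ler_pdivrMr // mulrC -ler_pdivrMr.
Qed.

(** Proper prime powers contribute at most [2 * ln x * F (sqrt x)]. The Potter bound with exponent 1
    gives [F (sqrt x) <= K * F x / sqrt x], which leaves [ln x / sqrt x] and tends to 0 relative to
    [F x]. *)
Lemma prime_sum_div_cvg (R : realType) (F : R -> R) (g : nat -> R) (s : R) : 1 < s ->
  (forall p, prime p -> 0 <= g p) ->
  {homo F : x y / x <= y} -> (forall x, summatory (mangoldt_of g) x <= F x) ->
  (exists X, forall x, X <= x -> 0 < F x) ->
  (forall c, 0 < c -> F (c * x) / F x @[x --> +oo] --> c `^ s) ->
  (forall x, 1 <= x -> F x = summatory (fun m => summatory (mangoldt_of g) (x / m%:R)) x) ->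
  prime_sum g x / F x @[x --> +oo] --> (zeta s)^-1.
Proof.
move=> s1 g0 Fmono AF Fpos Fvar FA.
have A0 x : 0 <= summatory (mangoldt_of g) x.
  by apply: sumr_ge0 => n _; exact: mangoldt_of_ge0.
have AF' x : 0 <= summatory (mangoldt_of g) x <= F x by rewrite A0 AF.
have F0 x : 0 <= F x := le_trans (A0 x) (AF x).
have hA := mobius_asymptotic s1 Fmono AF' Fpos Fvar FA.
have [K [X0 [K0 X01 hK]]] := potter_bound ltr01 s1 Fmono F0 Fpos (Fvar 2 (ltr0n _ 2)).
have [Y hY] := Fpos.
have hd : (summatory (mangoldt_of g) x - prime_sum g x) / F x @[x --> +oo] --> (0 : R).
  apply/cvg_pinfty_distP => e e0.
  have e1 : 0 < e / (2 * K + 1) by rewrite divr_gt0 //; lra.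
  have /cvg_pinfty_distP/(_ _ e1)[Z hZ] := @cvg_ln_div_sqrt R.
  exists (Num.max X0 (Num.max Y Z)) => x; rewrite !ge_max => /and3P[xX /hY Fx /hZ].
  have x1 : 1 <= x by lra.
  have x0 : 0 < x by lra.
  have l0 : 0 <= ln x by rewrite ln_ge0.
  have s0 : 0 < Num.sqrt x by rewrite sqrtr_gt0.
  have s1' : 1 <= Num.sqrt x by rewrite -[leLHS]sqrtr1 ler_wsqrtr.
  have sx : Num.sqrt x * Num.sqrt x = x by rewrite -expr2 sqr_sqrtr // ltW.
  have sxx : Num.sqrt x <= x by rewrite -[leRHS]sx ler_peMl // ltW.
  have /andP[d0 d1] := prime_sum_bounds x1 g0.
  rewrite !subr0 => h; rewrite ger0_norm; last by rewrite divr_ge0.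
  rewrite ler_pdivrMr //; apply: (le_trans d1).
  have hk := hK x (Num.sqrt x) xX s1' sxx; rewrite powRr1 ?divr_ge0 ?(ltW s0) ?(ltW x0) // in hk.
  have sq : Num.sqrt x / x = (Num.sqrt x)^-1.
    by rewrite -[X in _ / X]sx invfM mulrA divff ?mul1r // gt_eqF.
  rewrite sq in hk.
  have l2 : 0 <= 2 * ln x by lra.
  apply: (le_trans (ler_wpM2l l2 (le_trans (AF _) hk))).
  rewrite (_ : 2 * ln x * (K / Num.sqrt x * F x) = 2 * K * (ln x / Num.sqrt x) * F x); last by ring.
  rewrite ler_pM2r //.
  have := ler_wpM2l (mulr_ge0 (ler0n _ 2) K0) (le_trans (ler_norm _) h).
  move/le_trans; apply; rewrite mulrA ler_pdivrMr; lra.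
have h := cvgB hA hd; rewrite subr0 in h.
by apply: (cvg_pinfty_eq _ (h _)); exists 0 => x _; rewrite /= -mulrBl opprB addrC subrK.
Qed.

Lemma prime_sumB (R : realType) (g : nat -> R) (x y : R) : x <= y ->
  prime_sum g y - prime_sum g x =
  \sum_((Num.truncn x).+1 <= p < (Num.truncn y).+1 | prime p) g p.
Proof.
move=> xy; rewrite /prime_sum (big_cat_nat _ (m := 1%N) (n := (Num.truncn x).+1)
  (p := (Num.truncn y).+1)) //=; last by rewrite ltnS le_truncn.
by rewrite addrC addrK.
Qed.

(** Termwise over the primes of [(x, y]], where [h x <= h p] and [ln p <= ln y]. *)
Lemma monotone_prime_sum_le (R : realType) (h : R -> R) (x y : R) :
  (forall x, 2 <= x -> 0 < h x) -> (forall x y, 2 <= x -> x <= y -> h x <= h y) ->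
  2 <= x -> x <= y ->
  h x * (theta y - theta x) <=
  ln y * (prime_sum (fun p => h p%:R) y - prime_sum (fun p => h p%:R) x).
Proof.
move=> h0 hm x2 xy; rewrite /theta !prime_sumB // !mulr_sumr.
rewrite big_nat_cond [leRHS]big_nat_cond.
apply: ler_sum => p /andP[/andP[xp py] pp].
have xp' : x <= p%:R by rewrite ltW // -truncn_lt_nat //; lra.
have py' : p%:R <= y by rewrite -truncn_ge_nat //; lra.
rewrite [leRHS]mulrC ler_pM ?ln_ge0 ?(ltW (h0 _ _)) ?ler1n ?prime_gt0 //.
  exact: hm.
by rewrite ler_ln ?posrE //; lra.
Qed.

Lemma monotone_prime_sum_ge (R : realType) (h : R -> R) (x y : R) :
  (forall x, 2 <= x -> 0 < h x) -> (forall x y, 2 <= x -> x <= y -> h x <= h y) ->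
  2 <= x -> x <= y ->
  ln x * (prime_sum (fun p => h p%:R) y - prime_sum (fun p => h p%:R) x) <=
  h y * (theta y - theta x).
Proof.
move=> h0 hm x2 xy; rewrite /theta !prime_sumB // !mulr_sumr.
rewrite big_nat_cond [leRHS]big_nat_cond.
apply: ler_sum => p /andP[/andP[xp py] pp].
have xp' : x <= p%:R by rewrite ltW // -truncn_lt_nat //; lra.
have py' : p%:R <= y by rewrite -truncn_ge_nat //; lra.
have p2 : 2 <= p%:R :> R by lra.
rewrite [leRHS]mulrC ler_pM ?ln_ge0 ?(ltW (h0 _ p2)) ?hm //; first by lra.
by rewrite ler_ln ?posrE //; lra.
Qed.

(** With [t = s * d], [(1 + d) ^ s <= exp t <= 1 / (1 - t)], and [t <= 1 / 2] makes this at most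
    [1 + t + 2 * t ^ 2]. *)
Lemma powR_secant_le (R : realType) (s d : R) : 0 < s -> 0 < d -> s * d <= 1 / 2 ->
  (1 + d) `^ s - 1 <= s * d * (1 + 2 * (s * d)).
Proof.
move=> s0 d0 sd; have t0 : 0 < s * d by rewrite mulr_gt0.
have d1 : 0 < 1 + d by lra.
have h1 : s * ln (1 + d) <= s * d by rewrite ler_pM2l // le_ln1Dx //; lra.
rewrite powR_expR //; rewrite -ler_expR in h1.
move: h1 (expR_gt0 (s * d)) (expRxMexpNx_1 (s * d)) (expR_ge1Dx (- (s * d))) t0 sd.
move: (expR (- (s * d))) (expR (s * d)) (expR (s * ln _)) => u v w.
move: (s * d) => t wv v0 uv h2 t0 t1; have : v * (1 - t) <= v * u by rewrite ler_pM2l //; lra.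
rewrite uv => tu.
have : v * (1 - t) * (1 + 2 * t) <= 1 * (1 + 2 * t) by rewrite ler_pM2r //; lra.
have : 0 <= v * (t * (1 - 2 * t)) by rewrite !mulr_ge0 //; lra.
nra.
Qed.

(** With [t = s * d], [(1 - d) ^ s <= exp (- t) <= 1 / (1 + t) <= 1 - t + t ^ 2]. *)
Lemma powR_secant_ge (R : realType) (s d : R) : 0 < s -> 0 < d -> d < 1 ->
  s * d * (1 - s * d) <= 1 - (1 - d) `^ s.
Proof.
move=> s0 d0 d1; have t0 : 0 < s * d by rewrite mulr_gt0.
have d1' : 0 < 1 - d by lra.
have h1 : s * ln (1 - d) <= - (s * d) by rewrite -mulrN ler_pM2l // le_ln1Dx //; lra.
rewrite powR_expR //; rewrite -ler_expR in h1.
move: h1 (expR_gt0 (- (s * d))) (expRxMexpNx_1 (s * d)) (expR_ge1Dx (s * d)) t0.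
move: (expR (- (s * d))) (expR (s * d)) (expR (s * ln _)) => u v w.
move: (s * d) => t wu u0 uv h2 t0; have : u * (1 + t) <= u * v by rewrite ler_pM2l.
rewrite [u * v]mulrC uv => tu.
nra.
Qed.

(* The short-interval Tauberian step: on [x, (1 + d) x] the prime number theorem makes
   [h x] comparable to the increment of the prime sum, up to the secant slope of
   [c |-> c ^ s / s] at [1], and [d] is arbitrarily small. *)
Lemma monotone_of_prime_sum (R : realType) (h G : R -> R) (s : R) : 1 < s ->
  (forall x, 2 <= x -> 0 < h x) -> (forall x y, 2 <= x -> x <= y -> h x <= h y) ->
  (exists X, forall x, X <= x -> 0 < G x) ->
  (forall c, 0 < c -> G (c * x) / G x @[x --> +oo] --> c `^ s) ->
  prime_sum (fun p => h p%:R) x / G x @[x --> +oo] --> s^-1 ->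
  h x * x / (G x * ln x) @[x --> +oo] --> (1 : R).
Proof.
move=> s1 h0 hm [X0 G0] Gvar hP; have s0 : 0 < s by lra.
pose P := prime_sum (fun p => h p%:R).
have Pc (c : R) : 0 < c -> P (c * x) / G x @[x --> +oo] --> c `^ s / s.
  move=> c0; have hh := cvgM (cvg_pinfty_scale c0 hP) (Gvar c c0).
  rewrite mulrC; apply: (cvg_pinfty_eq _ (hh _)); exists (X0 / c) => x.
  rewrite ler_pdivrMr // mulrC => /G0 Gx.
  by rewrite /= mulrA divfK // gt_eqF.
have Tc (c : R) : 0 < c -> theta (c * x) / x @[x --> +oo] --> c.
  move=> c0; have hh : theta (c * x) / (c * x) * c @[x --> +oo] --> 1 * c.
    by apply: cvgMr_tmp; exact: (cvg_pinfty_scale c0 (@prime_number_theorem R)).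
  rewrite mul1r in hh; apply: (cvg_pinfty_eq _ hh); exists 1 => x x1 /=.
  by field; rewrite !gt_eqF //; lra.
have P1 := Pc 1 ltr01; have T1 := Tc 1 ltr01.
apply/cvg_pinfty_distP => e e0.
(* The value 1/2 is the limit of [powR_secant_le]; [e / 4] keeps the secant slopes within
   [2 * t <= e / 2] of 1, leaving room for the convergence error [e / 4]. *)
pose t := Num.min (1 / 2) (e / 4).
have t0 : 0 < t by rewrite /t lt_min; apply/andP; split; lra.
have t1 : t <= 1 / 2 by rewrite /t ge_min lexx.
have te : t <= e / 4 by rewrite /t ge_min lexx orbT.
pose d := t / s.
have d0 : 0 < d by rewrite divr_gt0.
have sd : s * d = t by rewrite /d mulrCA divff ?mulr1 // gt_eqF.
have d1 : d < 1 by nra.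
have b0 : 0 < 1 + d by lra.
have a0 : 0 < 1 - d by lra.
(* [up] and [lo] are the two one-sided bounds for [h x * x / (G x * ln x)], arranged as products of
   quotients with known limits. *)
pose up x := ln ((1 + d) * x) / ln x *
  ((P ((1 + d) * x) / G x - P (1 * x) / G x) *
   (theta ((1 + d) * x) / x - theta (1 * x) / x)^-1).
pose lo x := ln ((1 - d) * x) / ln x *
  ((P (1 * x) / G x - P ((1 - d) * x) / G x) *
   (theta (1 * x) / x - theta ((1 - d) * x) / x)^-1).
have hT1 : theta ((1 + d) * x) / x - theta (1 * x) / x @[x --> +oo] --> 1 + d - 1.
  by apply: cvgB => //; exact: Tc.
have hT2 : theta (1 * x) / x - theta ((1 - d) * x) / x @[x --> +oo] --> 1 - (1 - d).
  by apply: cvgB => //; exact: Tc.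
have hup : up x @[x --> +oo] --> 1 * (((1 + d) `^ s / s - 1 `^ s / s) * (1 + d - 1)^-1).
  apply: cvgM; first exact: cvg_ln_scale.
  apply: cvgM; first by apply: cvgB => //; exact: Pc.
  by apply: cvgV => //; rewrite gt_eqF //; lra.
have hlo : lo x @[x --> +oo] --> 1 * ((1 `^ s / s - (1 - d) `^ s / s) * (1 - (1 - d))^-1).
  apply: cvgM; first exact: cvg_ln_scale.
  apply: cvgM; first by apply: cvgB => //; exact: Pc.
  by apply: cvgV => //; rewrite gt_eqF //; lra.
have lup : 1 * (((1 + d) `^ s / s - 1 `^ s / s) * (1 + d - 1)^-1) <= 1 + 2 * t.
  have sd2 : s * d <= 1 / 2 by rewrite sd.
  have := powR_secant_le s0 d0 sd2; rewrite sd powR1 => hs.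
  rewrite mul1r -mulrBl -mulrA -invfM (_ : s * (1 + d - 1) = t); last by rewrite -sd; ring.
  by rewrite ler_pdivrMr // mulrC.
have llo : 1 - t <= 1 * ((1 `^ s / s - (1 - d) `^ s / s) * (1 - (1 - d))^-1).
  have := powR_secant_ge s0 d0 d1; rewrite sd powR1 => hs.
  rewrite mul1r -mulrBl -mulrA -invfM (_ : s * (1 - (1 - d)) = t); last by rewrite -sd; ring.
  by rewrite ler_pdivlMr // mulrC.
have e4 : 0 < e / 4 by lra.
(* Both theta increments, divided by [x], tend to [d]; accuracy [d / 2] keeps them positive, so
   division by them preserves the inequalities. *)
have d2 : 0 < d / 2 by lra.
have /cvg_pinfty_distP/(_ _ e4)[X1 hX1] := hup.
have /cvg_pinfty_distP/(_ _ e4)[X2 hX2] := hlo.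
have /cvg_pinfty_distP/(_ _ d2)[X3 hX3] := hT1.
have /cvg_pinfty_distP/(_ _ d2)[X4 hX4] := hT2.
(* The bound [2 / (1 - d)] places [(1 - d) * x] in the range where [h] is monotone. *)
exists (Num.max (Num.max (Num.max X1 X2) (Num.max X3 X4)) (Num.max X0 (2 / (1 - d)))) => x.
rewrite !ge_max => /andP[/andP[/andP[/hX1 x1 /hX2 x2] /andP[/hX3 x3 /hX4 x4]] /andP[/G0 Gx x5]].
rewrite ler_pdivrMr // in x5.
have xx2 : 2 <= x by nra.
have x0 : 0 < x by lra.
have l0 : 0 < ln x by rewrite ln_gt0; lra.
have ax : (1 - d) * x <= x by nra.
have bx : x <= (1 + d) * x by nra.
have x5' : 2 <= (1 - d) * x by rewrite mulrC.
have Hup := monotone_prime_sum_le h0 hm xx2 bx; rewrite -/P in Hup.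
have Hlo := monotone_prime_sum_ge h0 hm x5' ax; rewrite -/P in Hlo.
rewrite /= ler_norml !mul1r in x3; rewrite /= ler_norml !mul1r in x4.
have {x3} th1 : 0 < theta ((1 + d) * x) / x - theta x / x by case/andP: x3; lra.
have {x4} th2 : 0 < theta x / x - theta ((1 - d) * x) / x by case/andP: x4; lra.
have Gl : 0 < G x * ln x by rewrite mulr_gt0.
have U : h x * x / (G x * ln x) <= up x.
  rewrite /up !mul1r; move: Hup th1; rewrite -!mulrBl.
  set T := theta _ - _; set Q := P _ - _; set l := ln (_ * x) => Hup th1.
  have T0 : 0 < T by move: th1; rewrite pmulr_lgt0 ?invr_gt0.
  rewrite (_ : h x * x / _ = h x * T * (x / (G x * ln x * T))); last first.
    by field; rewrite !gt_eqF.
  rewrite (_ : l / _ * _ = l * Q * (x / (G x * ln x * T))); last first.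
    by field; rewrite !gt_eqF.
  by rewrite ler_wpM2r // divr_ge0 ?(ltW x0) // mulr_ge0 ?(ltW Gl) ?(ltW T0).
have V : lo x <= h x * x / (G x * ln x).
  rewrite /lo !mul1r; move: Hlo th2; rewrite -!mulrBl.
  set T := theta _ - _; set Q := P _ - _; set l := ln (_ * x) => Hlo th2.
  have T0 : 0 < T by move: th2; rewrite pmulr_lgt0 ?invr_gt0.
  rewrite (_ : h x * x / _ = h x * T * (x / (G x * ln x * T))); last first.
    by field; rewrite !gt_eqF.
  rewrite (_ : l / _ * _ = l * Q * (x / (G x * ln x * T))); last first.
    by field; rewrite !gt_eqF.
  by rewrite ler_wpM2r // divr_ge0 ?(ltW x0) // mulr_ge0 ?(ltW Gl) ?(ltW T0).
move: x1 x2; rewrite !ler_norml => /andP[_ u1] /andP[l1 _].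
by apply/andP; split; lra.
Qed.

(** * Proof of the Tauberian theorem *)

Unset Implicit Arguments.

Theorem mainTheorem3 (R : realType) (rho : R) (L h : R -> R)
  (rho_gt0 : 0 < rho)
  (L_sv : slowly_varying L)
  (h_gt0 : forall x : R, 2 <= x -> 0 < h x)
  (h_nondecreasing : forall x y : R, 2 <= x -> x <= y -> h x <= h y)
  (h_sum : exists2 eps : R -> R, eps x @[x --> +oo] --> (0 : R) &
     \forall x \near +oo,
       \sum_(1 <= n < (Num.truncn x).+1) prime_power_sum h n =
       (zeta (rho + 1) / (rho + 1) + eps x)
         * (x `^ (rho + 1) * L x / ln x)) :
  h x / (x `^ rho * L x) @[x --> +oo] --> (1 : R).
Proof.
set s := rho + 1 in h_sum; have s1 : 1 < s by rewrite /s; lra.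
have [eps heps /near_pinftyP[X1 hX1]] := h_sum.
have [x0 x00 [Lpos _ Lvar]] := L_sv.
pose g p : R := h p%:R.
have g0 p : prime p -> 0 <= g p.
  by move=> pp; rewrite ltW // h_gt0 // ler_nat prime_gt1.
pose F (x : R) : R := \sum_(1 <= n < (Num.truncn x).+1) prime_power_sum h n.
pose A x := summatory (mangoldt_of g) x.
(* The comparison function of the hypothesis, regularly varying of index [s = rho + 1]; [F] inherits
   the index through [F x / G x --> zeta s / s]. *)
pose G x := x `^ s * L x / ln x.
have GP x : Num.max x0 2 <= x -> 0 < G x.
  rewrite ge_max => /andP[/Lpos Lx x2]; rewrite /G divr_gt0 ?ln_gt0 ?mulr_gt0 ?powR_gt0 //; lra.
have Gpos : exists X, forall x, X <= x -> 0 < G x by exists (Num.max x0 2).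
have Z0 : 0 < zeta s / s by rewrite divr_gt0 ?zeta_gt0 //; lra.
(* [prime_power_sum h] is the divisor sum of [mangoldt_of g], so summing it groups into values of
   [A] at [x / m]. *)
have FA x : 1 <= x -> F x = summatory (fun m => A (x / m%:R)) x.
  move=> x1; have xx0 : 0 <= x by lra.
  rewrite /F; transitivity (\sum_(1 <= k < (Num.truncn x).+1)
      \sum_(1 <= d < k.+1 | (d %| k)%N) mangoldt_of g d).
    by apply: eq_big_nat => n /andP[n0 _]; rewrite prime_power_sumE // sum_mangoldt_of_dvd.
  rewrite sum_divisor_sum; apply: eq_big_nat => n /andP[n0 _].
  by rewrite /A summatory_div.
have mg0 n : 0 <= mangoldt_of g n by exact: mangoldt_of_ge0.
have A0 x : 0 <= A x by apply: sumr_ge0.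
have AF x : A x <= F x.
  case: (leP 1 x) => [x1|x1]; last first.
    have -> : A x = 0; last first.
      apply: sumr_ge0 => n _; apply: sumr_ge0 => p pp; apply: sumr_ge0 => k _.
      by rewrite mulr_ge0 // g0.
    rewrite /A /summatory big_geq // ltnS leqNgt truncn_gt0 -ltNge; exact: x1.
  rewrite FA // /summatory big_ltn ?ltnS ?truncn_gt0 // divr1 lerDl.
  by apply: sumr_ge0 => n _; exact: A0.
have Fmono : {homo F : x y / x <= y}.
  move=> x y xy; apply: ler_sum_subrange => //; first by rewrite ltnS le_truncn.
  move=> n; apply: sumr_ge0 => p pp; apply: sumr_ge0 => k _.
  by rewrite mulr_ge0 // g0.
have FG : F x / G x @[x --> +oo] --> zeta s / s.
  have hh : zeta s / s + eps x @[x --> +oo] --> zeta s / s + 0.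
    by apply: cvgD => //; exact: cvg_cst.
  rewrite addr0 in hh; apply: (cvg_pinfty_eq _ hh).
  exists (Num.max X1 (Num.max x0 2)) => x; rewrite ge_max => /andP[/hX1 e xG].
  by rewrite /F e mulfK // gt_eqF // GP.
have Fpos : exists X, forall x, X <= x -> 0 < F x.
  have z2 : 0 < zeta s / s / 2 by rewrite divr_gt0.
  have /cvg_pinfty_distP/(_ _ z2)[X hX] := FG.
  exists (Num.max X (Num.max x0 2)) => x; rewrite ge_max => /andP[/hX].
  rewrite ler_norml => /andP[h1 _] /GP Gx.
  have : 0 < F x / G x by lra.
  by rewrite pmulr_lgt0 // invr_gt0.
have Gvar c : 0 < c -> G (c * x) / G x @[x --> +oo] --> c `^ s.
  move=> c0; have hh : c `^ s * (L (c * x) / L x) * (ln (c * x) / ln x)^-1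
      @[x --> +oo] --> c `^ s * 1 * 1^-1.
    apply: cvgM; first by apply: cvgMl_tmp; exact: Lvar.
    by apply: cvgV; [exact: oner_neq0 | exact: cvg_ln_scale].
  rewrite invr1 !mulr1 in hh; apply: (cvg_pinfty_eq _ hh).
  exists (Num.max (2 / c) (Num.max x0 2)) => x; rewrite ge_max => /andP[].
  rewrite ler_pdivrMr // mulrC => cx; rewrite ge_max => /andP[/Lpos Lx x2].
  have xx0 : 0 < x by lra.
  have lx : 0 < ln x by rewrite ln_gt0; lra.
  have lc : 0 < ln (c * x) by rewrite ln_gt0; lra.
  have ps : 0 < x `^ s by rewrite powR_gt0.
  by rewrite /G powRM ?(ltW c0) ?(ltW xx0) //; field; rewrite !gt_eqF.
have Fvar c : 0 < c -> F (c * x) / F x @[x --> +oo] --> c `^ s.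
  move=> c0; have hh : F (c * x) / G (c * x) * (G (c * x) / G x) * (F x / G x)^-1
      @[x --> +oo] --> zeta s / s * c `^ s * (zeta s / s)^-1.
    apply: cvgM; last by apply: cvgV => //; rewrite gt_eqF.
    by apply: cvgM; [exact: (cvg_pinfty_scale c0 FG) | exact: Gvar].
  rewrite mulrAC divff ?mul1r ?gt_eqF // in hh; apply: (cvg_pinfty_eq _ hh).
  have [Y hY] := Fpos.
  exists (Num.max Y (Num.max (Num.max x0 2) (Num.max x0 2 / c))) => x.
  rewrite ge_max => /andP[/hY Fx]; rewrite ge_max => /andP[/GP Gx].
  rewrite ler_pdivrMr // mulrC => /GP Gcx.
  by field; rewrite !gt_eqF.
have hPF := prime_sum_div_cvg s1 g0 Fmono AF Fpos Fvar FA.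
have hPG : prime_sum g x / G x @[x --> +oo] --> s^-1.
  have hh : prime_sum g x / F x * (F x / G x) @[x --> +oo] --> (zeta s)^-1 * (zeta s / s).
    exact: cvgM.
  rewrite mulrA mulVf ?mul1r ?gt_eqF ?zeta_gt0 // in hh.
  have [Y hY] := Fpos.
  apply: (cvg_pinfty_eq _ hh); exists Y => x /hY Fx.
  by rewrite mulrA divfK // gt_eqF.
(* Here [G x * ln x = x ^ (rho + 1) * L x], so the limit obtained is the claim after cancelling one
   factor [x]. *)
have := monotone_of_prime_sum s1 h_gt0 h_nondecreasing Gpos Gvar hPG.
apply: cvg_pinfty_eq; exists (Num.max x0 2) => x; rewrite ge_max => /andP[/Lpos Lx x2].
have xx0 : 0 < x by lra.
have lx : 0 < ln x by rewrite ln_gt0; lra.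
have ps : 0 < x `^ rho by rewrite powR_gt0.
have -> : G x = x `^ rho * x * L x / ln x.
  by rewrite /G /s powRD ?(gt_eqF xx0) ?implybT // powRr1 ?(ltW xx0).
by field; rewrite !gt_eqF.
Qed.
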